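(* Let $\alpha,\beta,\theta$ be cost functions satisfying $\alpha+\beta=\theta$. Then for all probability measures $\mu,\nu$ on $\mathbb{R}$ with finite first moments, $$\overline{\mathcal{T}}_\theta(\nu|\mu)=\overline{\mathcal{T}}_\alpha(\nu|\mu)+\overline{\mathcal{T}}_\beta(\nu|\mu).$$
   Context: A cost function is an even convex function $\theta:\mathbb{R}\to[0,\infty)$ with $\theta(0)=0$. For probability measures $\mu,\nu$ on $\mathbb{R}$ with finite first moments, the weak transport cost is $$\overline{\mathcal{T}}_\theta(\nu|\mu)=\inf_\pi\int\theta\Big(\big|x-\textstyle\int y\,p(x,dy)\big|\Big)\,\mu(dx).$$ The infimum runs over all couplings $\pi(dx\,dy)=\mu(dx)p(x,dy)$ with first marginal $\mu$ and second marginal $\nu$. *)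

(* Defs.v *)
From HB Require Import structures.
From mathcomp Require Import all_boot all_order all_algebra.
From mathcomp Require Import all_classical all_reals all_analysis.
Set Implicit Arguments. Unset Strict Implicit. Unset Printing Implicit Defensive.
Import Order.TTheory GRing.Theory Num.Theory.
Local Open Scope classical_set_scope.
Local Open Scope ring_scope.

Definition cost_function (R : realType) (th : R -> R) : Prop :=
  [/\ (forall x, th (- x) = th x),
      (forall x y t, 0 <= t <= 1 ->
          th (t * x + (1 - t) * y) <= t * th x + (1 - t) * th y),
      (forall x, 0 <= th x) &
      th 0 = 0].

Definition finite_first_moment (R : realType) (mu : probability R R) : Prop :=
  mu.-integrable setT (fun x : R => (x%:E)%E).

Definition barycenter (R : realType) (p : R.-pker R ~> R) (x : R) : R :=
  fine (\int[p x]_y (y%:E))%E.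

(* pi(dx dy) = mu(dx) p(x,dy) has second marginal nu *)
Definition second_marginal (R : realType) (mu nu : probability R R)
    (p : R.-pker R ~> R) : Prop :=
  forall B : set R, measurable B -> nu B = (\int[mu]_x p x B)%E.

Definition weak_cost (R : realType) (th : R -> R) (mu nu : probability R R)
    : \bar R :=
  ereal_inf [set (\int[mu]_x (th `|x - barycenter p x|)%:E)%E
            | p in [set p : R.-pker R ~> R | second_marginal mu nu p]].

(* Main.v *)
(** Let [F] and [G] be the quantile functions of [mu] and [nu] on ]0, 1[, and put [h = F - G].
    The optimal displacement [x - \int y p(x, dy)], read in the coordinate [u] with [x = F u],
    is the isotonic regression [f] of [h]: the slope of the greatest convex minorant of the
    primitive of [h]. It does not depend on the cost, so one kernel is optimal for [al], [be]
    and [th] simultaneously, and the optimal costs add up.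

    Lower bound: for each level [t], integrating the displacement of any competitor over
    [{u | f u > t}] (a half-line, with at most one split atom of [mu]) bounds the integral of
    its hinge [(x - t)^+] below by that of [f], because the barycenters over this set cannot
    exceed the top part of [nu]. The means agree, and hinges generate the convex functions.

    Attainment: [F - f] is nondecreasing and dominated by [G] in the convex order, so
    the inverse transform martingale coupling provides a kernel from it to [nu]. *)
Require Import Defs.
From HB Require Import structures.
From mathcomp Require Import all_boot all_order all_algebra.
From mathcomp Require Import all_classical all_reals all_analysis.
From mathcomp Require Import measurable_realfun lra ring.
Set Implicit Arguments. Unset Strict Implicit. Unset Printing Implicit Defensive.
Import Order.TTheory GRing.Theory Num.Theory.
Import numFieldNormedType.Exports.
Local Open Scope classical_set_scope.
Local Open Scope ring_scope.

(** * Quantile functions and the distributional transform *)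

Section cdf_quantile.
Variable R : realType.
Implicit Types (m : probability R R) (u x : R).

(** Only one inequality is at stake: the infimum of a sum always dominates the sum of the infima,
    and the converse asks for a minimiser common to all costs. This is why every estimate is stated
    level by level, without a cost. At level [t] the upper and the lower bound have the same value
    [H 1 - t - min_w (H w - t * w)], with [H] the primitive of [h]: up to an affine term, the
    Legendre transform of [H]. Hence the minimiser [argm t] comes before the isotonic regression,
    which is recovered as its generalized inverse; its properties follow from the minimality
    inequality, with no envelope to build and no derivative to take. The obstacle is that an atom
    [x] of [mu] does not determine its level [u]. An auxiliary uniform variable spreads the atom
    over its interval of levels. The displacement at [x] is then an average of [f] over these
    levels, and convexity of the hinges keeps the upper bound. *)

Definition cdfR m x : R := fine (m `]-oo, x]%classic).

Lemma cdfRE m x : (cdfR m x)%:E = m `]-oo, x]%classic.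
Proof. by rewrite fineK// fin_num_measure. Qed.

Lemma cdfR_homo m : {homo cdfR m : x y / x <= y}.
Proof.
move=> x y xy; rewrite -lee_fin !cdfRE; apply: le_measure; rewrite ?inE//.
by apply: subset_itvl; rewrite bnd_simp.
Qed.

Lemma cdfR_ge0 m x : 0 <= cdfR m x.
Proof. exact: fine_ge0. Qed.

Lemma cdfR_le1 m x : cdfR m x <= 1.
Proof. by rewrite -lee_fin cdfRE probability_le1. Qed.

Lemma measurable_cdfR m : measurable_fun setT (cdfR m).
Proof. by apply: nondecreasing_measurable => //; exact: cdfR_homo. Qed.

(** The identity as a random variable on [(R, m)]: its law is [m], so the limits and the right
    continuity of [cdf] apply to [cdfR m]. *)
Let idR : R -> R := idfun.

#[local] HB.instance Definition _ :=
  @isMeasurableFun.Build _ _ R R idR (@measurable_id _ _ setT).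

Let cdfR_cdf m x : (cdfR m x)%:E = cdf (idR : {RV m >-> R}) x.
Proof. by rewrite cdfRE. Qed.

Lemma cdfR_gt m u : u < 1 -> exists x, u < cdfR m x.
Proof.
move=> u1; have /fine_cvgP[_ h] := cvg_cdfy1 (idR : {RV m >-> R}).
near (+oo%R : set_system R) => x; exists x;
  rewrite [cdfR m x](_ : _ = (fine \o cdf (idR : {RV m >-> R})) x)//.
by near: x; exact: (cvgr_gt _ h).
Unshelve. all: by end_near. Qed.

Lemma cdfR_lt m u : 0 < u -> exists x, cdfR m x < u.
Proof.
move=> u1; have /fine_cvgP[_ h] := cvg_cdfNy0 (idR : {RV m >-> R}).
near (-oo%R : set_system R) => x; exists x;
  rewrite [cdfR m x](_ : _ = (fine \o cdf (idR : {RV m >-> R})) x)//.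
by near: x; exact: (cvgr_lt _ h).
Unshelve. all: by end_near. Qed.

Lemma cdfR_right m u x : (forall y, x < y -> u <= cdfR m y) -> u <= cdfR m x.
Proof.
move=> h; rewrite leNgt; apply/negP => xu.
have := @cdf_right_continuous _ _ _ m (idR : {RV m >-> R}) x.
rewrite -cdfR_cdf => /fine_cvgP[_ c].
near x^'+ => y.
have /h : x < y by near: y; exact: nbhs_right_gt.
apply/negP; rewrite -ltNge [cdfR m y](_ : _ = (fine \o cdf (idR : {RV m >-> R})) y)//.
by near: y; exact: (cvgr_lt _ c).
Unshelve. all: by end_near. Qed.

(* Quantile function; the value outside ]0, 1[ is junk. *)
Definition qf m u : R := if 0 < u < 1 then inf [set x | u <= cdfR m x] else 0.

(** Galois connection. From left to right it rests on right continuity, which puts the infimum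
    itself into the set. *)
Lemma qf_le m u x : 0 < u < 1 -> (qf m u <= x) = (u <= cdfR m x).
Proof.
move=> u01; rewrite /qf u01; case/andP: u01 => u0 u1.
have [y hy] := cdfR_gt m u1; have [z hz] := cdfR_lt m u0.
have lb : lbound [set x | u <= cdfR m x] z.
  move=> w /= uw; rewrite leNgt; apply/negP => wz.
  by have := cdfR_homo m (ltW wz); rewrite leNgt (lt_le_trans hz).
have hi : has_inf [set x | u <= cdfR m x].
  by split; [exists y; exact: ltW | exists z].
apply/idP/idP => [h|h]; last by apply: ge_inf => //; exists z.
apply: cdfR_right => w xw.
have [v /= uv vw] := inf_lt hi.1 (le_lt_trans h xw).
exact: le_trans uv (cdfR_homo m (ltW vw)).
Qed.

Lemma qf_homo m u v : 0 < u -> u <= v -> v < 1 -> qf m u <= qf m v.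
Proof.
move=> u0 uv v1; have v01 : 0 < v < 1 by rewrite v1 (lt_le_trans u0).
rewrite qf_le ?u0 ?(le_lt_trans uv)//.
by apply: (le_trans uv); rewrite -qf_le.
Qed.

Lemma measurable_qf m : measurable_fun setT (qf m).
Proof.
have q01 : measurable_fun setT (fun u : R => 0 < u < 1).
  by apply: measurable_and; apply: measurable_fun_ltr.
apply: measurable_fun_if => //.
rewrite setTI => mD; apply: (measurability _ (RGenOInfty.measurableE R)) => //.
move=> /= _ [_ [x ->]] <-.
rewrite (_ : _ `&` _ = `]0, 1[%classic `&` `]cdfR m x, +oo[%classic).
  exact: measurableI.
have qfE (u : R) : 0 < u < 1 -> inf [set x0 | u <= cdfR m x0] = qf m u by rewrite /qf => ->.
by apply/seteqP; split=> u /=; rewrite !in_itv/= !andbT => -[u01 h]; split => //; move: h;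
  rewrite qfE// !ltNge qf_le.
Qed.

End cdf_quantile.

(** * Laws of random variables and almost sure comparison *)

Section law.
Variable R : realType.

Lemma probability_ext (m1 m2 : probability R R) :
  (forall x, m1 `]-oo, x]%classic = m2 `]-oo, x]%classic) ->
  forall A, measurable A -> m1 A = m2 A.
Proof.
move=> m12.
have gt1 (m : probability R R) x : m `]x, +oo[%classic = (1 - m `]-oo, x]%classic)%E.
  by rewrite -(setCitvl (BRight x)) probability_setC.
apply: (measure_unique (@RGenOInfty.G R) (fun n => `](- n%:R)%R, +oo[%classic)).
- exact: RGenOInfty.measurableE.
- move=> _ _ [x ->] [y ->]; exists (Num.max x y).
  by apply/seteqP; split => z /=; rewrite !in_itv/= !andbT gt_max => /andP.
- by move=> n; exists (- n%:R).
- apply/seteqP; split => // z _; have [n _ nz] := nbhs_infty_gtr (- z).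
  by exists n => //=; rewrite in_itv/= andbT ltrNl; apply: nz => /=.
- by move=> _ [x ->]; rewrite [LHS](gt1 m1) [RHS](gt1 m2) m12.
- by move=> n; rewrite (le_lt_trans (probability_le1 _ _))// ltry.
Qed.

Definition has_law d (T : measurableType d) (l : probability T R) (X : T -> R)
    (m : probability R R) :=
  measurable_fun setT X /\ forall B, measurable B -> l (X @^-1` B) = m B.

Section has_law.
Context d (T : measurableType d) (l : probability T R) (X : T -> R).
Variable m : probability R R.

Lemma has_law_cdf : measurable_fun setT X ->
  (forall x, l (X @^-1` `]-oo, x]%classic) = m `]-oo, x]%classic) -> has_law l X m.
Proof.
move=> mX h; split => //.
pose X1 : {RV l >-> R} := HB.pack X (isMeasurableFun.Build _ _ _ _ X mX).
exact: (@probability_ext (distribution l X1) m h).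
Qed.

Hypothesis XL : has_law l X m.

Lemma has_law_ge0_integral (k : R -> \bar R) : measurable_fun setT k ->
  (forall x, 0 <= k x)%E -> (\int[m]_x k x = \int[l]_t k (X t))%E.
Proof.
case: XL => mX h mk k0.
rewrite -[RHS](ge0_integral_pushforward mX l measurableT)//.
by apply: eq_measure_integral => A mA _; apply/esym; exact: h.
Qed.

Lemma has_law_integrable (k : R -> R) : measurable_fun setT k ->
  m.-integrable setT (EFin \o k) <-> l.-integrable setT (EFin \o (k \o X)).
Proof.
move=> mk; have [mX h] := XL.
have e : (\int[m]_x `|(k x)%:E| = \int[l]_t `|(k (X t))%:E|)%E.
  by rewrite has_law_ge0_integral//; do 2 apply: measurableT_comp => //.
split=> /integrableP[_ i]; apply/integrableP; split.
- by apply/measurable_EFinP; apply: measurableT_comp.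
- by rewrite -[X in (X < _)%E]e.
- exact/measurable_EFinP.
- by rewrite [X in (X < _)%E]e.
Qed.

Lemma has_law_integral (k : R -> R) : measurable_fun setT k ->
  l.-integrable setT (EFin \o (k \o X)) ->
  (\int[m]_x (k x)%:E = \int[l]_t (k (X t))%:E)%E.
Proof.
case: XL => mX h mk ik.
rewrite -[RHS](@integral_pushforward _ _ _ _ _ _ mX l setT (EFin \o k))//.
  by apply: eq_measure_integral => A mA _; apply/esym; exact: h.
exact/measurable_EFinP.
Qed.

End has_law.

Lemma ae_measure_le d (T : measurableType d) (l : probability T R) (A B : set T) :
  measurable A -> measurable B -> {ae l, forall t, A t -> B t} -> (l A <= l B)%E.
Proof.
move=> mA mB [N [mN N0 AB]]; rewrite -[leRHS]adde0 -N0.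
apply: (@le_trans _ _ (l (B `|` N))); last exact: measureU2.
apply: le_measure; rewrite ?inE//; first exact: measurableU.
move=> t At; have [Bt|Bt] := pselect (B t); [by left|right].
by apply: AB => /= h; exact: Bt (h At).
Qed.

Lemma ae_measure_eq d (T : measurableType d) (l : probability T R) (A B : set T) :
  measurable A -> measurable B -> {ae l, forall t, A t <-> B t} -> l A = l B.
Proof.
move=> mA mB AB; apply/eqP; rewrite eq_le; apply/andP.
by split; apply: ae_measure_le => //; apply: filterS AB => t [].
Qed.

(* If [X <= Y] have the same law, every event [X <= q < Y] is null. *)
Lemma le_has_law_ae_eq d (T : measurableType d) (l : probability T R)
    (X Y : T -> R) (m : probability R R) :
  has_law l X m -> has_law l Y m -> {ae l, forall t, X t <= Y t} ->
  {ae l, forall t, X t = Y t}.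
Proof.
move=> [mX lX] [mY lY] XY.
have mXq q : measurable (X @^-1` `]-oo, q]%classic) by rewrite -[_ @^-1` _]setTI; exact: mX.
have mYq q : measurable (Y @^-1` `]-oo, q]%classic) by rewrite -[_ @^-1` _]setTI; exact: mY.
have Nq (q : R) : {ae l, forall t, X t <= q -> Y t <= q}.
  exists (X @^-1` `]-oo, q] `\` Y @^-1` `]-oo, q]); split.
  - exact: measurableD.
  - have YX0 : l (Y @^-1` `]-oo, q] `\` X @^-1` `]-oo, q]) = 0%E.
      apply: measure_negligible; first exact: measurableD.
      apply: negligibleS XY => t /= [] + Xq; rewrite !in_itv/= => Yq h.
      by apply: Xq; rewrite in_itv/= (le_trans h).
    have XYE : l (X @^-1` `]-oo, q]) = l (Y @^-1` `]-oo, q]) by rewrite lX// lY.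
    rewrite measureD//=; last by rewrite (le_lt_trans (probability_le1 _ _))// ltry.
    move: YX0; rewrite measureD//=; last by rewrite (le_lt_trans (probability_le1 _ _))// ltry.
    by rewrite setIC XYE.
  - by move=> t /= /not_implyP; rewrite /= !in_itv/=.
(* Rationals are enumerated through [unpickle], so that one null set serves all of them. *)
pose P n t := if unpickle n is Some r then X t <= ratr r -> Y t <= ratr r else True.
have : {ae l, forall t, forall n, P n t}.
  apply: ae_foralln => n; rewrite /P; case: unpickle => [r|]; first exact: Nq.
  by apply: aeW.
apply: filterS2 XY => t; rewrite le_eqVlt => /predU1P[//|XYt] h.
have [r] := rat_in_itvoo XYt; rewrite in_itv/= => /andP[Xr rY].
by have := h (pickle r); rewrite /P pickleK => /(_ (ltW Xr)); rewrite leNgt rY.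
Qed.

Lemma has_law_ae d (T : measurableType d) (l : probability T R)
    (X : T -> R) (m : probability R R) (P : R -> Prop) :
  has_law l X m -> {ae m, forall x, P x} -> {ae l, forall t, P (X t)}.
Proof.
move=> [mX lX] [N [mN N0 PN]]; exists (X @^-1` N); split.
- by rewrite -[_ @^-1` _]setTI; exact: mX.
- by rewrite lX.
- by move=> t; exact: PN.
Qed.

Lemma has_law_comp d (T : measurableType d) (l : probability T R)
    (X : T -> R) (m n : probability R R) (Y : R -> R) :
  has_law l X m -> has_law m Y n -> has_law l (Y \o X) n.
Proof.
move=> [mX lX] [mY mYn]; split; first exact: measurableT_comp.
move=> B mB; rewrite comp_preimage lX ?mYn//.
by rewrite -[_ @^-1` _]setTI; exact: mY.
Qed.

End law.

(** * The uniform law on ]0, 1[ *)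

Section uniform.
Variable R : realType.

Definition uniform01 (l : probability R R) :=
  forall a : R, 0 <= a <= 1 -> l `]-oo, a]%classic = a%:E.

Lemma uniform01_ex : exists l : probability R R, uniform01 l.
Proof.
(* [uniform_prob] lives on [measurableTypeR R]; the identity transports it to [R]. *)
have mid : measurable_fun setT (id : measurableTypeR R -> R) by move=> _ B mB; rewrite setTI.
pose X : {mfun measurableTypeR R >-> R} := HB.pack (id : measurableTypeR R -> R)
  (isMeasurableFun.Build _ _ _ _ _ mid).
exists (distribution (uniform_prob (@ltr01 R)) X) => a /andP[a0 a1].
rewrite /distribution /pushforward/= preimage_id /uniform_prob integral_uniform_pdf.
rewrite (_ : _ `&` _ = `[0, a]%classic); last first.
  apply/seteqP; split=> x /=; rewrite !in_itv/=; first by move=> [-> /andP[->]].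
  by move=> /andP[-> xa]; rewrite xa (le_trans xa).
rewrite (eq_integral (fun=> 1%:E)); last first.
  move=> x; rewrite inE/= in_itv/= /uniform_pdf => /andP[x0 xa].
  by rewrite x0 (le_trans xa)//= subr0 invr1.
rewrite integral_cst//= mul1e lebesgue_measure_itv/= lte_fin.
by case: ltgtP a0 => // [_|<-] _; rewrite ?subr0// sube0.
Qed.

Variables (l : probability R R) (ul : uniform01 l).

Lemma uniform01_01 : {ae l, forall u, 0 < u < 1}.
Proof.
have n0 : l.-negligible `]-oo, 0]%classic.
  by apply/negligibleP => //; apply: etrans (ul _) _; rewrite ?lexx ?ler01.
have n1 : l.-negligible `[1, +oo[%classic.
  suff : l `[1, +oo[%classic = 0%E by move=> h; apply/negligibleP.
  apply/eqP; rewrite eq_le measure_ge0 andbT.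
  apply/lee_addgt0Pr => e e0; rewrite add0e.
  pose b := Num.max 0 (1 - e).
  have b01 : 0 <= b <= 1 by rewrite le_max lexx/= ge_max ler01/= gerBl ltW.
  have b1 : b < 1 by rewrite gt_max ltr01/= ltrBlDr ltrDl.
  apply: (@le_trans _ _ (l (~` `]-oo, b]%classic))).
    apply: le_measure; rewrite ?inE//; first exact: measurableC.
    move=> x /=; rewrite !in_itv/= andbT => x1; apply/negP.
    by rewrite -ltNge (lt_le_trans b1).
  by rewrite probability_setC// ul// lee_fin lerBlDl -lerBlDr le_max lexx orbT.
apply: negligibleS (negligibleU n0 n1) => u /= /negP.
by rewrite negb_and -!leNgt !in_itv/= andbT => /orP[]; [left|right].
Qed.

Lemma uniform01_qf m : has_law l (qf m) m.
Proof.
apply: has_law_cdf; first exact: measurable_qf.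
move=> x; rewrite -cdfRE -ul ?cdfR_ge0 ?cdfR_le1//.
have mq : measurable (qf m @^-1` `]-oo, x]%classic).
  by rewrite -[_ @^-1` _]setTI; exact: measurable_qf.
apply: ae_measure_eq => //; apply: filterS uniform01_01 => u u01 /=.
by rewrite !in_itv/= qf_le.
Qed.

(** Two one-sided bounds suffice: the upper bound on open half-lines passes to closed ones by
    raising the level by an arbitrary [e]. *)
Lemma uniform01_law d (T : measurableType d) (P : probability T R) (X : T -> R) :
  measurable_fun setT X -> {ae P, forall t, 0 <= X t <= 1} ->
  (forall a : R, 0 < a < 1 -> (P (X @^-1` `]-oo, a[%classic) <= a%:E)%E) ->
  (forall a : R, 0 < a < 1 -> (a%:E <= P (X @^-1` `]-oo, a]%classic))%E) ->
  has_law P X l.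
Proof.
move=> mX X01 lt le; apply: has_law_cdf => // a.
have mXI (i : interval R) : measurable (X @^-1` [set` i]).
  by rewrite -[_ @^-1` _]setTI; exact: mX.
have [a0|a0] := ltP a 0.
  rewrite (@ae_measure_eq _ _ _ P _ set0)// ?measure0.
    rewrite (@ae_measure_eq _ _ _ l _ set0)// ?measure0//.
    apply: filterS uniform01_01 => u /andP[u0 _] /=; rewrite in_itv/=.
    by split => // ua; have := lt_trans u0 (le_lt_trans ua a0); rewrite ltxx.
  apply: filterS X01 => u /andP[u0 _] /=; rewrite in_itv/=.
  by split => // ua; have := le_lt_trans u0 (le_lt_trans ua a0); rewrite ltxx.
have [a1|a1] := leP 1 a.
  rewrite (@ae_measure_eq _ _ _ P _ setT)//.
    rewrite (@ae_measure_eq _ _ _ l _ setT)// ?probability_setT//.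
    apply: filterS uniform01_01 => u /andP[_ u1] /=; rewrite in_itv/=.
    by split => // _; rewrite (le_trans _ a1)// ltW.
  apply: filterS X01 => u /andP[_ u1] /=; rewrite in_itv/=.
  by split => // _; rewrite (le_trans _ a1).
rewrite ul ?a0 ?ltW//; apply/eqP; rewrite eq_le; apply/andP; split; last first.
  have [->|an0] := eqVneq a 0; first exact: measure_ge0.
  by apply: le; rewrite a1 andbT lt_neqAle eq_sym an0.
apply/lee_addgt0Pr => e e0; rewrite -EFinD.
have [e1|e1] := leP (1 - a) e.
  by rewrite (le_trans (probability_le1 _ _))// lee_fin -lerBlDl.
apply: le_trans (lt (a + e) _); last by rewrite ltr_pwDr//= -ltrBrDl.
apply: le_measure; rewrite ?inE// => t /=; rewrite !in_itv/= => h.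
by rewrite (le_lt_trans h)// ltrDl.
Qed.

End uniform.

(** * Filling the jumps of a distribution function *)

Section distributional_transform.
Variable R : realType.
Implicit Types (m : probability R R) (x : R).

Definition cdfL m x : R := fine (m `]-oo, x[%classic).

Lemma cdfLE m x : (cdfL m x)%:E = m `]-oo, x[%classic.
Proof. by rewrite fineK// fin_num_measure. Qed.

Lemma cdfL_homo m : {homo cdfL m : x y / x <= y}.
Proof.
move=> x y xy; rewrite -lee_fin !cdfLE; apply: le_measure; rewrite ?inE//.
by apply: subset_itvl; rewrite bnd_simp.
Qed.

Lemma cdfL_ge0 m x : 0 <= cdfL m x.
Proof. exact: fine_ge0. Qed.

Lemma cdfL_le m x : cdfL m x <= cdfR m x.
Proof.
rewrite -lee_fin cdfLE cdfRE; apply: le_measure; rewrite ?inE//.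
by apply: subset_itvl; rewrite bnd_simp.
Qed.

Lemma cdfRL m x y : x < y -> cdfR m x <= cdfL m y.
Proof.
move=> xy; rewrite -lee_fin cdfLE cdfRE; apply: le_measure; rewrite ?inE//.
by apply: subset_itvl; rewrite bnd_simp.
Qed.

Lemma cdf_atom m x : m [set x] = (cdfR m x - cdfL m x)%:E.
Proof.
have : m `]-oo, x]%classic = (m `]-oo, x[%classic + m [set x])%E.
  rewrite -measureU//; first by rewrite setUitv1.
  by apply/seteqP; split => // y [] /= + yx; rewrite yx in_itv/= ltxx.
rewrite -cdfRE -cdfLE EFinB => ->.
by rewrite addeAC subee// add0e.
Qed.

Lemma cdfL_left m x a : (forall y, y < x -> cdfR m y <= a) -> cdfL m x <= a.
Proof.
move=> h.
have c : (m \o (fun n => `]-oo, x - n.+1%:R^-1]%classic)) n @[n --> \oo] -->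
    m (\bigcup_n `]-oo, x - n.+1%:R^-1]%classic).
  apply: nondecreasing_cvg_mu => //; first exact: bigcup_measurable.
  move=> i j ij; apply/subsetPset/subset_itvl; rewrite bnd_simp lerD2l lerN2.
  by rewrite lef_pV2 ?posrE// ler_nat.
have -> : (cdfL m x <= a) = (m `]-oo, x[%classic <= a%:E)%E by rewrite -lee_fin cdfLE.
have -> : `]-oo, x[%classic = \bigcup_n `]-oo, x - n.+1%:R^-1]%classic.
  apply/seteqP; split => y /=.
    rewrite in_itv/= => /ltr_add_invr[k yk]; exists k => //=.
    by rewrite in_itv/= lerBrDr ltW.
  move=> [k _] /=; rewrite !in_itv/= => /le_lt_trans; apply.
  by rewrite ltrBlDr ltrDl invr_gt0.
rewrite -(cvg_lim _ c)//.
apply: lime_le; first by apply/cvg_ex; eexists; exact: c.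
apply: nearW => n; rewrite -[leLHS]cdfRE lee_fin h// ltrBlDr ltrDl invr_gt0//.
Qed.
(* Randomized distributional transform: with [z.2] uniform, the jump of the
   distribution function at [z.1] is filled uniformly. *)
Definition rdt m (z : R * R) : R := cdfL m z.1 + z.2 * (cdfR m z.1 - cdfL m z.1).

Variables (l : probability R R) (ul : uniform01 l).

Section quantile_weight.
Variables (m : probability R R) (a : R).
Hypothesis a01 : 0 < a < 1.
Let q := qf m a.
Let k := (a - cdfL m q) / (cdfR m q - cdfL m q).

(* Indicator of the mass below level [a]; the atom at the quantile is split. *)
Definition qweight x : R :=
  \1_(`]-oo, qf m a[%classic) x +
  (a - cdfL m (qf m a)) / (cdfR m (qf m a) - cdfL m (qf m a)) * \1_[set qf m a] x.

Lemma qf_cdfR : a <= cdfR m q.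
Proof. by rewrite -qf_le. Qed.

Lemma cdfR_ltq x : x < q -> cdfR m x < a.
Proof. by rewrite !ltNge qf_le. Qed.

Lemma qf_cdfL : cdfL m q <= a.
Proof. by apply: cdfL_left => y /cdfR_ltq/ltW. Qed.

Let k01 : 0 <= k <= 1.
Proof.
have h1 := qf_cdfR; have h2 := qf_cdfL; rewrite /k.
have [->|n0] := eqVneq (cdfR m q - cdfL m q) 0; first by rewrite invr0 mulr0 lexx ler01.
have p : 0 < cdfR m q - cdfL m q by rewrite lt_neqAle eq_sym n0/=; lra.
by rewrite divr_ge0 ?subr_ge0 ?cdfL_le//= ler_pdivrMr// mul1r lerD2r.
Qed.

Let kE : cdfL m q + k * (cdfR m q - cdfL m q) = a.
Proof.
have h1 := qf_cdfR; have h2 := qf_cdfL; rewrite /k.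
(* Without an atom at [q], [cdfL m q <= a <= cdfR m q] collapses to equalities, and the default
   value of the quotient is multiplied by zero. *)
have [e|n0] := eqVneq (cdfR m q - cdfL m q) 0; last by rewrite divfK//; lra.
by rewrite e mulr0 addr0; lra.
Qed.

Lemma qweightE x : qweight x = if x < q then 1 else if x == q then k else 0.
Proof.
rewrite /qweight -/q -/k !indicE; case: ltgtP => h.
- by rewrite mem_set ?memNset/= ?in_itv//= ?mulr0 ?addr0// => e; move: h; rewrite e ltxx.
- by rewrite !memNset/= ?in_itv/= ?mulr0 ?addr0// => [e|]; [move: h;
  rewrite e ltxx|rewrite ltNge ltW].
- by rewrite memNset/= ?in_itv/= ?h ?ltxx// mem_set//= mulr1 add0r.
Qed.

Lemma qweight01 x : 0 <= qweight x <= 1.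
Proof. by rewrite qweightE; case: ifP => _; [|case: ifP => _]; rewrite ?ler01 ?lexx. Qed.

Lemma measurable_qweight : measurable_fun setT qweight.
Proof.
apply: measurable_funD; first exact: measurable_indic.
by apply: measurable_funM => //; exact: measurable_indic.
Qed.

Lemma integral_qweight : (\int[m]_x (qweight x)%:E)%E = a%:E.
Proof.
rewrite /qweight -/q -/k; under eq_integral do rewrite EFinD EFinM.
rewrite ge0_integralD//=; last 3 first.
- by apply/measurable_EFinP; exact: measurable_indic.
- by move=> x _; rewrite -EFinM lee_fin mulr_ge0//; case/andP: k01.
- by apply/measurable_EFinP; apply: measurable_funM => //; exact: measurable_indic.
rewrite ge0_integralZl//=; last 2 first.
- by apply/measurable_EFinP; exact: measurable_indic.
- by rewrite lee_fin; case/andP: k01.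
rewrite !integral_indic// !setIT.
by rewrite [X in (X + _ * _)%E](esym (cdfLE _ _)) [X in (_ + _ * X)%E]cdf_atom -EFinM -EFinD kE.
Qed.

Let mS (i : interval R) x : measurable [set v | rdt m (x, v) \in i].
Proof.
rewrite -[X in measurable X]setTI.
have : measurable_fun setT (fun v => rdt m (x, v)).
  by rewrite /rdt/=; apply: measurable_funD => //; apply: measurable_funM.
by move=> /(_ measurableT [set` i]); apply.
Qed.

(** For fixed [x] the transform fills the interval from [cdfL m x] to [cdfR m x]. This lies on one
    side of [a] unless [x] is the quantile, where a fraction [k] of it is below [a]. The half-line
    is open because a point beyond the quantile may still be sent exactly to [a]; the companion
    [rdt_le] uses the closed one. *)
Lemma rdt_lt x : (l [set v | rdt m (x, v) \in `]-oo, a[] <= (qweight x)%:E)%E.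
Proof.
have cLR := cdfL_le m x; rewrite qweightE; case: ltgtP => [_|qx|xq].
- exact: probability_le1.
- rewrite (@ae_measure_eq _ _ _ l _ set0)// ?measure0//.
  apply: filterS (uniform01_01 ul) => v /andP[v0 _] /=; rewrite in_itv/= /rdt/=; split => // va.
  have : 0 <= v * (cdfR m x - cdfL m x) by rewrite mulr_ge0 ?subr_ge0// ltW.
  have := cdfRL m qx; have := qf_cdfR; lra.
- rewrite -ul//; apply: ae_measure_le => //; apply: aeW => v /=; rewrite !in_itv/= /rdt/= xq.
  have [e|] := eqVneq (cdfL m q) (cdfR m q); last rewrite eq_sym => n0.
    by have := qf_cdfR; have := qf_cdfL; rewrite e subrr mulr0; lra.
  have p : 0 < cdfR m q - cdfL m q by rewrite subr_gt0 lt_neqAle eq_sym n0 -xq.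
  by move=> h; rewrite /k ler_pdivlMr//; lra.
Qed.

Lemma rdt_le x : ((qweight x)%:E <= l [set v | rdt m (x, v) \in `]-oo, a]])%E.
Proof.
have cLR := cdfL_le m x; rewrite qweightE; case: ltgtP => [xq|//|xq].
- rewrite -(@probability_setT _ _ _ l); apply: ae_measure_le => //.
  apply: filterS (uniform01_01 ul) => v /andP[_ v1] _ /=; rewrite in_itv/= /rdt/=.
  have : v * (cdfR m x - cdfL m x) <= cdfR m x - cdfL m x.
    by rewrite ler_piMl ?subr_ge0// ltW.
  have := cdfR_ltq xq; lra.
- rewrite -ul//; apply: ae_measure_le => //; apply: aeW => v /=; rewrite !in_itv/= /rdt/= xq.
  have [e|] := eqVneq (cdfL m q) (cdfR m q); last rewrite eq_sym => n0.
    by have := qf_cdfR; have := qf_cdfL; rewrite e subrr mulr0; lra.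
  have p : 0 < cdfR m q - cdfL m q by rewrite subr_gt0 lt_neqAle eq_sym n0 -xq.
  by rewrite /k ler_pdivlMr//; lra.
Qed.

End quantile_weight.

Lemma measurable_rdt m : measurable_fun setT (rdt m).
Proof.
have mL : measurable_fun setT (cdfL m) by apply: nondecreasing_measurable => //; exact: cdfL_homo.
have mR := measurable_cdfR m.
apply: measurable_funD; first exact: measurableT_comp.
by apply: measurable_funM => //; apply: measurable_funB; exact: measurableT_comp.
Qed.

Lemma product_ae2 m (P : R -> Prop) : {ae l, forall v, P v} ->
  {ae (m \x l)%E, forall z, P z.2}.
Proof.
move=> [N [mN N0 PN]]; exists (setT `*` N); split.
- exact: measurableX.
- by rewrite product_measure1E//= N0 mule0.
- by move=> [x v] /= h; split => //; exact: PN.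
Qed.

(** The product measure integrates the sections, so [rdt_lt] and [rdt_le] both integrate to the
    total mass [a] of [qweight]. *)
Lemma rdt_law m : has_law (m \x l)%E (rdt m) l.
Proof.
have mq a := measurable_qweight m a.
have mrI (i : interval R) : measurable (rdt m @^-1` [set` i]).
  by rewrite -[_ @^-1` _]setTI; exact: measurable_rdt.
apply: uniform01_law => //; first exact: measurable_rdt.
- apply: filterS (product_ae2 m (uniform01_01 ul)) => -[x v] /= /andP[v0 v1].
  rewrite /rdt/=; have := cdfL_le m x; have := cdfL_ge0 m x; have := cdfR_le1 m x.
  move=> h1 h2 h3; have d0 : 0 <= cdfR m x - cdfL m x by rewrite subr_ge0.
  have : 0 <= v * (cdfR m x - cdfL m x) by rewrite mulr_ge0// ltW.
  have : v * (cdfR m x - cdfL m x) <= cdfR m x - cdfL m x by rewrite ler_piMl// ltW.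
  lra.
- move=> a a01; rewrite -(integral_qweight m a01).
  apply: ge0_le_integral => //.
  + by apply: measurable_fun_xsection; exact: mrI.
  + exact/measurable_EFinP.
  + move=> x _ /=; rewrite (_ : xsection _ _ = [set v | rdt m (x, v) \in `]-oo, a[]);
    first exact: rdt_lt.
    by rewrite /xsection; apply/seteqP; split=> v /=; rewrite inE.
- move=> a a01; rewrite -(integral_qweight m a01).
  apply: ge0_le_integral => //.
  + by move=> x _; rewrite lee_fin; case/andP: (qweight01 m a01 x).
  + exact/measurable_EFinP.
  + by apply: measurable_fun_xsection; exact: mrI.
  + move=> x _ /=; rewrite (_ : xsection _ _ = [set v | rdt m (x, v) \in `]-oo, a]]);
    first exact: rdt_le.
    by rewrite /xsection; apply/seteqP; split=> v /=; rewrite inE.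
Qed.

(* For [u = rdt (x, v)] Galois gives [qf m u <= x], and both sides have law [m]. *)
Lemma qf_rdt m : {ae (m \x l)%E, forall z, qf m (rdt m z) = z.1}.
Proof.
apply: (@le_has_law_ae_eq _ _ _ _ _ _ m).
- exact: has_law_comp (rdt_law m) (uniform01_qf ul m).
- split => // B mB; rewrite (_ : _ @^-1` _ = B `*` setT); last first.
    by apply/seteqP; split => [[]//|[x v] []].
  by rewrite [LHS]product_measure1E//= probability_setT mule1.
- have h1 := product_ae2 m (uniform01_01 ul).
  have h2 := has_law_ae (rdt_law m) (uniform01_01 ul).
  apply: filterS2 h1 h2 => -[x v] /= /andP[v0 v1] u01.
  rewrite qf_le// /rdt/=.
  have : v * (cdfR m x - cdfL m x) <= cdfR m x - cdfL m x.
    by rewrite ler_piMl ?subr_ge0 ?cdfL_le// ltW.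
  lra.
Qed.

Section atomless.
Variable m : probability R R.
Hypothesis m0 : forall x, m [set x] = 0%E.

(** Without atoms there is no jump to fill: [rdt m z] is [cdfR m z.1], and the probability integral
    transform is read off [rdt_law]. *)
Lemma cdfR_law : has_law m (cdfR m) l.
Proof.
have E z : rdt m z = cdfR m z.1.
  have := cdf_atom m z.1; rewrite m0 => -[] /esym e; rewrite /rdt e mulr0 addr0.
  by apply/eqP; rewrite -subr_eq0 -opprB e oppr0.
have [mr h] := rdt_law m; split=> [|B mB]; first exact: measurable_cdfR.
rewrite -h// (_ : rdt m @^-1` B = (cdfR m @^-1` B) `*` setT); last first.
  by apply/seteqP; split => [[x v]|[x v] []]; rewrite /= E.
rewrite [RHS]product_measure1E//= ?probability_setT ?mule1//.
by rewrite -[_ @^-1` _]setTI; exact: measurable_cdfR.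
Qed.

Lemma cdfR_qf u : 0 < u < 1 -> cdfR m (qf m u) = u.
Proof.
move=> u01; apply/eqP; rewrite eq_le (qf_cdfR _ u01)//=.
by have := qf_cdfL m u01; have := cdf_atom m (qf m u); rewrite m0 andbT => -[]; lra.
Qed.

(** Galois gives [qf m (cdfR m u) <= u], and both sides have law [m]. *)
Lemma qf_cdfR_ae : {ae m, forall u, qf m (cdfR m u) = u}.
Proof.
apply: (@le_has_law_ae_eq _ _ _ _ _ _ m) => //.
- exact: has_law_comp cdfR_law (uniform01_qf ul m).
- apply: filterS (has_law_ae cdfR_law (uniform01_01 ul)) => u u01.
  by rewrite qf_le.
Qed.

End atomless.

End distributional_transform.

(** * Inverse transform martingale coupling *)

Section density.
Context d (T : measurableType d) (R : realType) (l : probability T R) (f : T -> R).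
Hypotheses (mf : measurable_fun setT f) (f0 : forall x, 0 <= f x).
Hypothesis f1 : (\int[l]_x (f x)%:E = 1)%E.

Definition density (A : set T) : \bar R := (\int[l]_(x in A) (f x)%:E)%E.

Let density0 : density set0 = 0%E.
Proof. by rewrite /density integral_set0. Qed.

Let density_ge0 A : (0 <= density A)%E.
Proof. by apply: integral_ge0 => x _; rewrite lee_fin. Qed.

Let density_sigma_additive : semi_sigma_additive density.
Proof.
move=> F mF tF mUF; rewrite /density ge0_integral_bigcup//=.
- apply: is_cvg_ereal_nneg_natsum_cond => n _ _.
  by apply: integral_ge0 => x _; rewrite lee_fin.
- exact/measurable_funTS/measurable_EFinP.
- by move=> x _; rewrite lee_fin.
Qed.

#[local] HB.instance Definition _ := isMeasure.Build _ _ _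
  density density0 density_ge0 density_sigma_additive.

Let density_setT : density setT = 1%E.
Proof. exact: f1. Qed.

#[local] HB.instance Definition _ :=
  @Measure_isProbability.Build _ _ R density density_setT.

Import HBNNSimple.

Let density_nnsfun (g : {nnsfun T >-> R}) :
  (\int[density]_x (g x)%:E = \int[l]_x ((g x)%:E * (f x)%:E))%E.
Proof.
under [LHS]eq_integral do rewrite fimfunE -fsumEFin//.
rewrite [LHS]ge0_integral_fsum//; last 2 first.
  - by move=> r; exact/measurable_EFinP/measurableT_comp.
  - by move=> n x _; rewrite EFinM nnfun_muleindic_ge0.
under [RHS]eq_integral.
  move=> x _; rewrite fimfunE -fsumEFin// ge0_mule_fsuml; last first.
    by move=> r; rewrite EFinM nnfun_muleindic_ge0.
  over.
rewrite [RHS]ge0_integral_fsum//; last 2 first.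
  - move=> r; apply: emeasurable_funM; last exact/measurable_EFinP.
    by apply/measurable_EFinP/measurableT_comp.
  - by move=> n x _; apply: mule_ge0; [rewrite EFinM nnfun_muleindic_ge0|rewrite lee_fin].
apply: eq_fsbigr => r /set_mem [x0 _ rE].
rewrite integralZl_indic_nnsfun// integral_indic// setIT.
rewrite /density; under [RHS]eq_integral do rewrite EFinM -muleA.
have r0 : 0 <= r by rewrite -rE.
rewrite ge0_integralZl//=.
- congr (_ * _)%E; rewrite /density [LHS]integral_mkcond; apply: eq_integral => x _.
  by rewrite patchE indicE; case: ifPn => _; rewrite ?mul1e ?mul0e.
- apply: emeasurable_funM; last exact/measurable_EFinP.
  exact/measurable_EFinP/measurable_indic.
- by move=> x _; rewrite -EFinM lee_fin mulr_ge0.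
Qed.

Let density_integral (k : T -> \bar R) :
  measurable_fun setT k -> (forall x, 0 <= k x)%E ->
  (\int[density]_x k x = \int[l]_x (k x * (f x)%:E))%E.
Proof.
move=> mk k0; pose k_ := nnsfun_approx measurableT mk.
transitivity (lim (\int[density]_x (k_ n x)%:E @[n --> \oo])%E).
  rewrite -monotone_convergence//=.
  - apply: eq_integral => ? /[!inE] xD; apply/esym/cvg_lim => //=.
    exact: cvg_nnsfun_approx.
  - by move=> n; exact/measurable_EFinP/measurable_funTS.
  - by move=> n ? _; rewrite lee_fin.
  - by move=> ? _ ? ? mn; rewrite lee_fin; exact/lefP/nd_nnsfun_approx.
under eq_fun do rewrite density_nnsfun.
rewrite -monotone_convergence//=.
- apply: eq_integral => x _; apply/cvg_lim => //=.
  by apply: cvgeZr => //; exact: cvg_nnsfun_approx.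
- move=> n; apply: emeasurable_funM; last exact/measurable_EFinP.
  exact/measurable_EFinP.
- by move=> n x _; rewrite mule_ge0 ?lee_fin.
- move=> x _ a b ab; rewrite lee_wpmul2r ?lee_fin//.
  exact/lefP/nd_nnsfun_approx.
Qed.

Lemma density_prob : exists P : probability T R,
  (forall A, P A = \int[l]_(x in A) (f x)%:E)%E /\
  (forall k : T -> \bar R, measurable_fun setT k -> (forall x, 0 <= k x)%E ->
    (\int[P]_x k x = \int[l]_x (k x * (f x)%:E))%E).
Proof. by exists density; split => // k; exact: density_integral. Qed.

End density.

(** * Increasing rearrangement of one density into another *)

Section monotone_swap.
Variables (R : realType) (l : probability R R).
Hypothesis ul : uniform01 l.

Lemma uniform01_atomless x : l [set x] = 0%E.
Proof.
have ulR (a : R) : 0 <= a <= 1 -> cdfR l a = a.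
  by move=> a01; apply/EFin_inj; rewrite cdfRE ul.
rewrite cdf_atom; congr EFin; apply/eqP; rewrite subr_eq0 eq_le cdfL_le andbT.
have [x0|x0] := leP x 0.
  by rewrite (le_trans (cdfR_homo l x0))// ulR ?lexx ?ler01// cdfL_ge0.
have [x1|x1] := ltP 1 x.
  by rewrite (le_trans (cdfR_le1 _ _))// (le_trans _ (cdfRL l x1))// ulR ?lexx ?ler01.
rewrite ulR ?x1 ?(ltW x0)//; apply/ler_addgt0Pr => e e0; rewrite -lerBlDr.
have [h|h] := leP (x - e) 0; first exact: le_trans h (cdfL_ge0 _ _).
have xe : x - e < x by rewrite ltrBlDr ltrDl.
by rewrite (le_trans _ (cdfRL l xe))// ulR// ltW//= (le_trans (ltW xe)).
Qed.

Lemma has_law_ae_inv d (T : measurableType d) (P : probability T R)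
    (X : T -> R) (m : probability R R) (A : set R) : measurable A ->
  has_law P X m -> {ae P, forall t, A (X t)} -> {ae m, forall x, A x}.
Proof.
move=> mA [mX PX] h; exists (~` A); split => //; first exact: measurableC.
rewrite -PX; last exact: measurableC.
apply: measure_negligible; first by rewrite -[X in measurable X]setTI; apply: mX => //;
  exact: measurableC.
exact: h.
Qed.

(** The density has integral zero on a [P]-null set, hence vanishes [l]-almost everywhere on it.
    Only points of positive density are recovered. *)
Lemma density_ae (P : probability R R) (f : R -> R) (Q : R -> Prop) :
  measurable_fun setT f -> (forall x, 0 <= f x) ->
  (forall A, P A = \int[l]_(x in A) (f x)%:E)%E ->
  {ae P, forall x, Q x} -> {ae l, forall x, 0 < f x -> Q x}.
Proof.
move=> mf f0 Pf [N [mN N0 QN]].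
have /ae_eq_integral_abs : (\int[l]_(x in N) `|(f x)%:E| = 0)%E.
  by rewrite -N0 Pf; apply: eq_integral => x _; rewrite gee0_abs ?lee_fin.
move=> /(_ mN) h.
have /h : measurable_fun N (fun x => (f x)%:E) by apply/measurable_EFinP/measurable_funTS.
apply: filterS => x /= + fx; rewrite -[Q x]notE => NQ.
by move=> /QN/NQ [] fx0; move: fx; rewrite fx0 ltxx.
Qed.

Lemma ae_density (P : probability R R) (f : R -> R) (Q : R -> Prop) :
  (forall A, P A = \int[l]_(x in A) (f x)%:E)%E ->
  measurable_fun setT f ->
  {ae l, forall x, Q x} -> {ae P, forall x, Q x}.
Proof.
move=> Pf mf [N [mN N0 QN]]; exists N; split => //.
by rewrite Pf null_set_integral//; apply/measurable_EFinP/measurable_funTS.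
Qed.

(** Dividing by the mass [M] makes quantiles available for [f]. Two densities of equal mass share
    the factor [M], so it disappears when they are compared. *)
Lemma finite_density (f : R -> R) (M : R) : 0 < M ->
    measurable_fun setT f -> (forall x, 0 <= f x) ->
    (\int[l]_x (f x)%:E = M%:E)%E -> exists P : probability R R,
  [/\ forall w : R, (M%:E * P `]-oo, w]%classic = \int[l]_(x in `]-oo, w]) (f x)%:E)%E,
    forall x, P [set x] = 0%E,
    forall Q : R -> Prop, {ae P, forall x, Q x} -> {ae l, forall x, 0 < f x -> Q x},
    {ae P, forall x, 0 < f x /\ 0 < x < 1} &
    forall k : R -> \bar R, measurable_fun setT k -> (forall x, 0 <= k x)%E ->
      (\int[l]_x (k x * (f x)%:E) = M%:E * \int[P]_x k x)%E].
Proof.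
move=> M0 mf f0 fM.
have fM0 x : 0 <= f x / M by rewrite divr_ge0// ltW.
have mfM : measurable_fun setT (fun x => f x / M) by apply: measurable_funM.
have MV : (M%:E * M^-1%:E = 1)%E by rewrite -EFinM mulfV ?gt_eqF.
have i1 : (\int[l]_x (f x / M)%:E = 1)%E.
  under eq_integral do rewrite EFinM.
  rewrite ge0_integralZr//=; [by rewrite fM|exact/measurable_EFinP|..].
    by move=> x _; rewrite lee_fin.
  by rewrite lee_fin invr_ge0 ltW.
have [P [PA Pk]] := density_prob mfM fM0 i1.
have fMQ (Q : R -> Prop) : {ae l, forall x, 0 < f x / M -> Q x} <-> {ae l, forall x, 0 < f x -> Q
  x}.
  by split; apply: filterS => x + h; apply; move: h; rewrite ?pmulr_lgt0 ?invr_gt0.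
exists P; split => //.
- move=> w; rewrite PA; under eq_integral do rewrite EFinM muleC.
  rewrite ge0_integralZl//=.
  + by rewrite muleA MV mul1e.
  + exact/measurable_funTS/measurable_EFinP.
  + by move=> x _; rewrite lee_fin.
  + by rewrite lee_fin invr_ge0 ltW.
- move=> x; rewrite PA null_set_integral//; last exact: uniform01_atomless.
  exact/measurable_funTS/measurable_EFinP.
- by move=> Q /(density_ae mfM fM0 PA)/fMQ.
- have h1 := ae_density PA mfM (uniform01_01 ul).
  suff h2 : {ae P, forall x, 0 < f x} by apply: filterS2 h2 h1.
  exists (f @^-1` `]-oo, 0]%classic); split.
  + by rewrite -[X in measurable X]setTI; exact: mf.
  + rewrite PA integral0_eq// => x /=; rewrite in_itv/= => fx.
    have -> : f x = 0 by apply/eqP; rewrite eq_le fx f0.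
    by rewrite mul0r.
  + by move=> x /= /negP; rewrite -leNgt in_itv.
- move=> k mk k0; rewrite Pk// -ge0_integralZl//=.
  + apply: eq_integral => x _; rewrite EFinM.
    by rewrite [RHS]muleC -!muleA [(M^-1%:E * _)%E]muleC MV mule1.
  + by apply: emeasurable_funM => //; exact/measurable_EFinP.
  + by move=> x _; rewrite mule_ge0// lee_fin.
  + by rewrite lee_fin ltW.
Qed.

(* [phi] is the increasing rearrangement of the density [p] into the density [n]
   and [psi] its inverse; the order of the two distribution functions gives
   [u <= phi u]. *)
Lemma monotone_swap (p n : R -> R) (M : R) : 0 < M ->
  measurable_fun setT p -> measurable_fun setT n ->
  (forall x, 0 <= p x) -> (forall x, 0 <= n x) ->
  (\int[l]_x (p x)%:E = M%:E)%E -> (\int[l]_x (n x)%:E = M%:E)%E ->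
  (forall w : R, (0 < w < 1)%R -> \int[l]_(x in `]-oo, w]) (n x)%:E <=
    \int[l]_(x in `]-oo, w]) (p x)%:E)%E ->
  exists phi psi : R -> R, [/\ measurable_fun setT phi, measurable_fun setT psi,
    {ae l, forall u, 0 < p u -> [/\ u <= phi u, phi u < 1 & 0 < n (phi u)]},
    {ae l, forall v, 0 < n v -> [/\ 0 < psi v, psi v <= v & 0 < p (psi v)]} &
    forall h : R * R -> \bar R, measurable_fun setT h -> (forall z, 0 <= h z)%E ->
      (\int[l]_u (h (u, phi u) * (p u)%:E) = \int[l]_v (h (psi v, v) * (n v)%:E))%E].
Proof.
move=> M0 mp mn p0 n0 pM nM np.
have [P [Pw Pat Pae Ppos Pint]] := finite_density M0 mp p0 pM.
have [N [Nw Nat Nae Npos Nint]] := finite_density M0 mn n0 nM.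
have NP w : 0 < w < 1 -> cdfR N w <= cdfR P w.
  move=> /np; rewrite -Nw -Pw lee_pmul2l// ?lte_fin//.
  by rewrite -!cdfRE lee_fin.
have phiL := has_law_comp (cdfR_law ul Pat) (uniform01_qf ul N).
have psiL := has_law_comp (cdfR_law ul Nat) (uniform01_qf ul P).
set phi := qf N \o cdfR P in phiL *; set psi := qf P \o cdfR N in psiL *.
have mphi : measurable_fun setT phi by case: phiL.
have mpsi : measurable_fun setT psi by case: psiL.
have PU := has_law_ae (cdfR_law ul Pat) (uniform01_01 ul).
have Pphi := has_law_ae phiL Npos.
have psiphi : {ae P, forall u, psi (phi u) = u}.
  apply: filterS2 PU (qf_cdfR_ae ul Pat) => u u01 e.
  by rewrite /psi/phi/= cdfR_qf.
have le_phi : {ae P, forall u, u <= phi u}.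
  apply: filterS3 (filterI PU Pphi) Ppos (qf_cdfR_ae ul Pat) => u [u01 [_ phi01]] [_ uu] e.
  rewrite leNgt; apply/negP => phiu.
  (* Galois gives [cdfR P u <= cdfR N (phi u)] and [NP] replaces [N] by [P]; applying [qf P], which
     sends [cdfR P u] back to [u], yields [u <= phi u]. *)
  have : cdfR P u <= cdfR P (phi u).
    by apply: le_trans (NP _ phi01); rewrite -qf_le.
  by rewrite -qf_le// e leNgt phiu.
(* Since [phi] carries [P] to [N], it suffices to check these properties at [v = phi u], where
   [psi v = u]. *)
have good : {ae N, forall v, [/\ 0 < psi v, psi v <= v & 0 < p (psi v)]}.
  have mset : measurable [set v | [/\ 0 < psi v, psi v <= v & 0 < p (psi v)]].
    rewrite (_ : mkset _ = (fun v => [&& 0 < psi v, psi v <= v & 0 < p (psi v)]) @^-1` [set true]).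
      rewrite -[X in measurable X]setTI; apply: measurable_and => //.
        exact: measurable_fun_ltr.
      apply: measurable_and; first exact: measurable_fun_ler.
      by apply: measurable_fun_ltr => //; exact: measurableT_comp.
    by apply/seteqP; split => v /=; [move=> [-> -> ->]|move=> /and3P[]].
  apply: (has_law_ae_inv mset phiL).
  apply: filterS3 le_phi Ppos psiphi => u uphi [pu /andP[u0 _]] e /=.
  by rewrite e.
exists phi, psi; split => //.
- apply: Pae; apply: filterS2 le_phi Pphi => u uphi [nphi /andP[_ phi1]].
  by split.
- exact: Nae.
- move=> h mh h0.
  have m1 : measurable_fun setT (fun u => h (u, phi u)).
    by apply: measurableT_comp => //; exact: measurable_fun_pair.
  have m2 : measurable_fun setT (fun v => h (psi v, v)).
    by apply: measurableT_comp => //; exact: measurable_fun_pair.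
  rewrite Pint// Nint//.
  (* Both sides integrate [h] along the same coupling, parametrised by [u] or by [v = phi u]. *)
  congr (_ * _)%E; rewrite (has_law_ge0_integral phiL)//.
  apply: ae_eq_integral => //; first exact: measurableT_comp m2 mphi.
  by apply: filterS psiphi => u e _; rewrite e.
Qed.

End monotone_swap.

Lemma measurable_invr (R : realType) : measurable_fun setT (@GRing.inv R).
Proof.
rewrite -(setvU [set (0 : R)]).
have e : [set x : R | x != 0] = [set~ 0] by apply/seteqP; split => x /= /eqP.
apply/measurable_funU => //; first exact: measurableC.
split; last exact: measurable_fun_set1.
rewrite -e; apply: open_continuous_measurable_fun; first exact: open_neq.
by move=> x; rewrite inE => x0; apply: cvgV => //; exact: cvg_id.
Qed.

(** * Exchange of mass with prescribed barycenters *)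

Section martingale_swap.
Variables (R : realType) (l : probability R R).
Hypothesis ul : uniform01 l.

Lemma integral_posneg (A : set R) (f : R -> R) : measurable A ->
  l.-integrable A (EFin \o f) ->
  (\int[l]_(x in A) (f x)%:E = \int[l]_(x in A) (Num.max (f x) 0)%:E
     - \int[l]_(x in A) (Num.max (- f x) 0)%:E)%E /\
  (\int[l]_(x in A) (Num.max (f x) 0)%:E)%E \is a fin_num /\
  (\int[l]_(x in A) (Num.max (- f x) 0)%:E)%E \is a fin_num.
Proof.
move=> mA fi.
have e1 : (\int[l]_(x in A) (Num.max (f x) 0)%:E = \int[l]_(x in A) (EFin \o f)^\+%E x)%E.
  by apply: eq_integral => x _; rewrite funeposE EFin_max.
have e2 : (\int[l]_(x in A) (Num.max (- f x) 0)%:E = \int[l]_(x in A) (EFin \o f)^\-%E x)%E.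
  by apply: eq_integral => x _; rewrite funenegE EFin_max.
split; first by rewrite e1 e2 -integralE.
rewrite e1 e2; split; apply: integrable_fin_num => //.
- exact: integrable_funepos.
- exact: integrable_funeneg.
Qed.

Variables g G : R -> R.
Hypotheses (mg : measurable_fun setT g) (mG : measurable_fun setT G).
Hypothesis dint : l.-integrable setT (EFin \o (g \- G)).
Hypothesis gnd : forall u v, 0 < u -> u <= v -> v < 1 -> g u <= g v.
(** Quantile form of the convex order: together with [D1], the primitive of [g] dominates that of
    [G] and the means agree. *)
Hypothesis D0 : forall w : R, 0 < w < 1 ->
  (0 <= \int[l]_(x in `]-oo, w]) (g x - G x)%:E)%E.
Hypothesis D1 : (\int[l]_x (g x - G x)%:E = 0)%E.

(* Inverse transform martingale coupling (Jourdain and Margheriti): where [g] and [G]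
   differ, the mass at [G u] is exchanged with the mass at [G (chi u)], where [chi]
   matches the positive part of [g - G] with its negative part. *)
Lemma martingale_swap : exists chi pi : R -> R, [/\
  measurable_fun setT chi, measurable_fun setT pi, forall u, 0 <= pi u <= 1,
  {ae l, forall u, (1 - pi u) * G u + pi u * G (chi u) = g u} &
  forall k : R -> \bar R, measurable_fun setT k -> (forall x, 0 <= k x)%E ->
    (\int[l]_u ((1 - pi u)%:E * k (G u) + (pi u)%:E * k (G (chi u))) =
     \int[l]_u k (G u))%E].
Proof.
pose d := g \- G; have md : measurable_fun setT d by exact: measurable_funB.
pose p x := Num.max (d x) 0; pose n x := Num.max (- d x) 0.
have mp : measurable_fun setT p by apply: measurable_maxr.
have mn : measurable_fun setT n by apply: measurable_maxr => //; exact: measurableT_comp.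
have p0 x : 0 <= p x by rewrite /p le_max lexx orbT.
have n0 x : 0 <= n x by rewrite /n le_max lexx orbT.
have [dE [pf nf]] := integral_posneg measurableT dint.
have pn : (\int[l]_x (n x)%:E = \int[l]_x (p x)%:E)%E.
  have /eqP : (\int[l]_x (p x)%:E - \int[l]_x (n x)%:E = 0)%E := etrans (esym dE) D1.
  by rewrite sube_eq ?fin_num_adde_defl// add0e => /eqP.
have pM : (\int[l]_x (p x)%:E = (fine (\int[l]_x (p x)%:E))%:E)%E by rewrite fineK.
move: pM; set M := fine _ => pM.
have nM : (\int[l]_x (n x)%:E = M%:E)%E by rewrite pn.
have : 0 <= M by rewrite fine_ge0// integral_ge0// => x _; rewrite lee_fin.
(* For [M = 0] the densities cannot be normalised, but then [g = G] almost everywhere and no mass is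
   moved. *)
rewrite le_eqVlt => /predU1P[M0|M0].
  have ae0 (f : R -> R) : measurable_fun setT f -> (forall x, 0 <= f x) ->
      (\int[l]_x (f x)%:E = M%:E)%E -> {ae l, forall x, f x = 0}.
    move=> mf f0 fM.
    have /ae_eq_integral_abs : (\int[l]_(x in setT) `|(f x)%:E| = 0)%E.
      by rewrite -[RHS]/(0%:E) M0 -fM; apply: eq_integral => x _; rewrite gee0_abs ?lee_fin.
    move=> /(_ measurableT) h.
    have /h : measurable_fun setT (fun x => (f x)%:E) by apply/measurable_EFinP.
    by apply: filterS => x /(_ I)[].
  exists id, (fun=> 0); split => //.
  - by move=> u; rewrite lexx ler01.
  - apply: filterS2 (ae0 p mp p0 pM) (ae0 n mn n0 nM) => u pu nu.
    rewrite mul0r subr0 mul1r addr0; have : d u = 0.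
      have h1 : d u <= p u by rewrite le_max lexx.
      have h2 : - d u <= n u by rewrite le_max lexx.
      by apply/eqP; rewrite eq_le -{1}pu h1 -oppr_le0 -nu.
    by rewrite /d/=; lra.
  - move=> k mk k0; apply: eq_integral => u _.
    by rewrite subr0 mul1e mul0e adde0.
have np w : 0 < w < 1 -> (\int[l]_(x in `]-oo, w]) (n x)%:E <= \int[l]_(x in `]-oo, w]) (p x)%:E)%E.
  move=> /D0; have [] := @integral_posneg `]-oo, w]%classic d.
  - by [].
  - by apply: integrableS dint.
  - by move=> e [_ nw] h; have := h; rewrite [X in (_ <= X)%E -> _]e sube_ge0 ?nw ?orbT.
have [phi [psi [mphi mpsi Pae Nae swap]]] := monotone_swap ul M0 mp mn p0 n0 pM nM np.
have dp u : 0 < p u -> 0 < d u by rewrite /p lt_max ltxx orbF.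
have dn u : 0 < n u -> d u < 0 by rewrite /n lt_max ltxx orbF oppr_gt0.
have pP u : 0 < d u -> p u = d u /\ n u = 0.
  by move=> du; rewrite /p/n max_l ?(ltW du)// max_r// oppr_le0 ltW.
have pN u : d u < 0 -> p u = 0 /\ n u = - d u.
  by move=> du; rewrite /p/n max_r ?(ltW du)// max_l// oppr_ge0 ltW.
(* [phi u] lies to the right of [u], and [g < G] there, so [G u < g u <= g (phi u) < G (phi u)]. *)
have orderP : {ae l, forall u, 0 < d u -> G u < g u /\ g u < G (phi u)}.
  apply: filterS2 (uniform01_01 ul) Pae => u /andP[u0 u1] h du.
  have [] := h; first by rewrite (pP u du).1.
  move=> uphi phi1 /dn nphi; split; first by move: du; rewrite /d/= subr_gt0.
  have := gnd u0 uphi phi1; move: nphi; rewrite /d/=; lra.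
have orderN : {ae l, forall u, d u < 0 -> g u < G u /\ G (psi u) < g u}.
  apply: filterS2 (uniform01_01 ul) Nae => u /andP[u0 u1] h du.
  have [] := h; first by rewrite (pN u du).2 oppr_gt0.
  move=> psi0 psiu /dp nphi; split; first by move: du; rewrite /d/= subr_lt0.
  have := gnd psi0 psiu u1; move: nphi; rewrite /d/=; lra.
(* The weight that solves [(1 - pi u) * G u + pi u * G (chi u) = g u]. The inner tests hold almost
   everywhere; they keep [pi] between 0 and 1 at every point. *)
pose pi u := if 0 < d u then
    (if g u < G (phi u) then d u / (G (phi u) - G u) else 0)
  else if d u < 0 then
    (if G (psi u) < g u then d u / (G (psi u) - G u) else 0) else 0.
pose chi u := if 0 < d u then phi u else psi u.
have mchi : measurable_fun setT chi.
  by apply: measurable_fun_ifT => //; apply: measurable_fun_ltr.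
have mGphi : measurable_fun setT (G \o phi) by exact: measurableT_comp.
have mGpsi : measurable_fun setT (G \o psi) by exact: measurableT_comp.
have minv := @measurable_invr R.
have mpi : measurable_fun setT pi.
  apply: measurable_fun_ifT => //; first exact: measurable_fun_ltr.
    apply: measurable_fun_ifT => //; first exact: measurable_fun_ltr.
    by apply: measurable_funM => //; apply: measurableT_comp => //; apply: measurable_funB.
  apply: measurable_fun_ifT => //; first exact: measurable_fun_ltr.
  apply: measurable_fun_ifT => //; first exact: measurable_fun_ltr.
  by apply: measurable_funM => //; apply: measurableT_comp => //; apply: measurable_funB.
have pi01 u : 0 <= pi u <= 1.
  rewrite /pi /d/=; case: ifPn => [|_]; last first.
    case: ifPn => [|_]; last by rewrite lexx ler01.
    case: ifPn => [|_ _]; last by rewrite lexx ler01.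
    move=> h1 h2; rewrite -[_ / _]opprK -mulrN -invrN opprB -mulNr.
    have h3 : 0 < G u - G (psi u) by lra.
    by rewrite divr_ge0 ?(ltW h3)//= ?ler_pdivrMr//; lra.
  case: ifPn => [|_ _]; last by rewrite lexx ler01.
  move=> h1 h2; have h3 : 0 < G (phi u) - G u by lra.
  by rewrite divr_ge0 ?(ltW h3)//= ?ler_pdivrMr//; lra.
exists chi, pi; split => //.
- apply: filterS2 orderP orderN => u oP oN; rewrite /pi/chi.
  case: ltgtP oP oN => [du|du|du] oP oN.
  + have [_ h] := oP erefl; rewrite h; have h3 : G (phi u) - G u != 0 by rewrite gt_eqF//;
    move: du; rewrite /d/=; lra.
    by rewrite mulrBl mul1r addrAC -addrA -mulrBr divfK// /d/= addrC subrK.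
  + have [_ h] := oN erefl; rewrite h; have h3 : G (psi u) - G u != 0 by rewrite lt_eqF//;
    move: du; rewrite /d/=; lra.
    by rewrite mulrBl mul1r addrAC -addrA -mulrBr divfK// /d/= addrC subrK.
  + by rewrite mul0r subr0 mul1r addr0; move: du; rewrite /d/=; lra.
move=> k mk k0.
(* Almost everywhere [pi u] is [w (u, phi u) * p u] where [d] is positive and [w (psi u, u) * n u]
   where it is negative. The two ends of an exchanged pair thus carry the same weight [w], and
   [swap] equates what one gives with what the other receives. *)
pose w (z : R * R) := if G z.1 < G z.2 then (G z.2 - G z.1)^-1 else 0.
have w0 z : 0 <= w z by rewrite /w; case: ifP => // h; rewrite invr_ge0 subr_ge0 ltW.
have mG1 : measurable_fun setT (fun z : R * R => G z.1) by exact: measurableT_comp.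
have mG2 : measurable_fun setT (fun z : R * R => G z.2) by exact: measurableT_comp.
have mw : measurable_fun setT w.
  apply: measurable_fun_ifT => //; first exact: measurable_fun_ltr.
  by apply: measurableT_comp => //; exact: measurable_funB.
pose h1 (z : R * R) := ((w z)%:E * k (G z.1))%E.
pose h2 (z : R * R) := ((w z)%:E * k (G z.2))%E.
have mh1 : measurable_fun setT h1.
  by apply: emeasurable_funM; [exact/measurable_EFinP|exact: measurableT_comp mk mG1].
have mh2 : measurable_fun setT h2.
  by apply: emeasurable_funM; [exact/measurable_EFinP|exact: measurableT_comp mk mG2].
have h10 z : (0 <= h1 z)%E by rewrite mule_ge0 ?lee_fin.
have h20 z : (0 <= h2 z)%E by rewrite mule_ge0 ?lee_fin.
have mphi2 : measurable_fun setT (fun u => (u, phi u)) by exact: measurable_fun_pair.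
have mpsi2 : measurable_fun setT (fun v => (psi v, v)) by exact: measurable_fun_pair.
have mkG : measurable_fun setT (fun u => k (G u)) by exact: measurableT_comp.
have mkGc : measurable_fun setT (fun u => k (G (chi u))).
  by apply: measurableT_comp => //; exact: measurableT_comp.
have mpiE : measurable_fun setT (fun u => (pi u)%:E) by exact/measurable_EFinP.
have mpiE' : measurable_fun setT (fun u => (1 - pi u)%:E).
  by apply/measurable_EFinP; apply: measurable_funB.
have mpE : measurable_fun setT (fun u => (p u)%:E) by exact/measurable_EFinP.
have mnE : measurable_fun setT (fun u => (n u)%:E) by exact/measurable_EFinP.
have pi0 u : (0 <= (pi u)%:E)%E by rewrite lee_fin; case/andP: (pi01 u).
have pi1 u : (0 <= (1 - pi u)%:E)%E by rewrite lee_fin subr_ge0; case/andP: (pi01 u).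
have split2 (h h' : R * R -> \bar R) : measurable_fun setT h -> measurable_fun setT h' ->
    (forall z, 0 <= h z)%E -> (forall z, 0 <= h' z)%E ->
    (\int[l]_u (h (u, phi u) * (p u)%:E + h' (psi u, u) * (n u)%:E) =
     \int[l]_u (h (u, phi u) * (p u)%:E) + \int[l]_u (h' (psi u, u) * (n u)%:E))%E.
  move=> mh mh' hh hh'; rewrite ge0_integralD//.
  - by move=> u _; rewrite mule_ge0 ?lee_fin.
  - by apply: emeasurable_funM => //; exact: measurableT_comp mh mphi2.
  - by move=> u _; rewrite mule_ge0 ?lee_fin.
  - by apply: emeasurable_funM => //; exact: measurableT_comp mh' mpsi2.
have msum (h h' : R * R -> \bar R) : measurable_fun setT h -> measurable_fun setT h' ->
    measurable_fun setT (fun u => h (u, phi u) * (p u)%:E + h' (psi u, u) * (n u)%:E)%E.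
  move=> mh mh'; apply: emeasurable_funD; apply: emeasurable_funM => //.
    exact: measurableT_comp mh mphi2.
  exact: measurableT_comp mh' mpsi2.
have piE : {ae l, forall u,
    ((pi u)%:E * k (G u) = h1 (u, phi u) * (p u)%:E + h2 (psi u, u) * (n u)%:E)%E /\
    ((pi u)%:E * k (G (chi u)) = h2 (u, phi u) * (p u)%:E + h1 (psi u, u) * (n u)%:E)%E}.
  apply: filterS2 orderP orderN => u oP oN; rewrite /pi/chi/h1/h2/w/=.
  case: ltgtP oP oN => [du|du|du] oP oN.
  - have [oP1 oP2] := oP erefl; rewrite (pP u du).1 (pP u du).2 oP2 (lt_trans oP1 oP2).
    by rewrite !mule0 !adde0 !(muleAC _ _ (d u)%:E) -!EFinM [_^-1 * _]mulrC.
  - have [oN1 oN2] := oN erefl; rewrite (pN u du).1 (pN u du).2 oN2 (lt_trans oN2 oN1).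
    rewrite !mule0 !add0e !(muleAC _ _ (- d u)%:E) -!EFinM.
    suff -> : d u / (G (psi u) - G u) = (G u - G (psi u))^-1 * - d u by [].
    by rewrite -[X in _ / X]opprB invrN !mulrN mulrC.
  - have pu : p u = 0 by rewrite /p max_r// -?du.
    have nu : n u = 0 by rewrite /n max_r// -?du ?oppr0.
    by rewrite pu nu !mule0 !mul0e adde0.
(* [swap] turns each integral against [p] into one against [n]; the two sides then differ by the
   order of their terms. *)
have E1 : (\int[l]_u ((pi u)%:E * k (G (chi u))) = \int[l]_u ((pi u)%:E * k (G u)))%E.
  rewrite (ae_eq_integral (fun u => h2 (u, phi u) * (p u)%:E + h1 (psi u, u) * (n u)%:E)%E)//;
    last 3 first.
  - exact: emeasurable_funM.
  - exact: msum.
  - by apply: filterS piE => u [].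
  rewrite [RHS](ae_eq_integral (fun u => h1 (u, phi u) * (p u)%:E + h2 (psi u, u) * (n
    u)%:E)%E)//; last 3 first.
  - exact: emeasurable_funM.
  - exact: msum.
  - by apply: filterS piE => u [].
  by rewrite !split2// swap// [in RHS]swap// addeC.
rewrite ge0_integralD//; last 4 first.
- by move=> u _; rewrite mule_ge0.
- exact: emeasurable_funM.
- by move=> u _; rewrite mule_ge0.
- exact: emeasurable_funM.
rewrite E1 -ge0_integralD//; last 4 first.
- by move=> u _; rewrite mule_ge0.
- exact: emeasurable_funM.
- by move=> u _; rewrite mule_ge0.
- exact: emeasurable_funM.
by apply: eq_integral => u _; rewrite -ge0_muleDl// -EFinD subrK mul1e.
Qed.

End martingale_swap.

(** * Isotonic regression *)

Section integrable_EFin.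
Context d (T : measurableType d) (R : realType) (l : {measure set T -> \bar R}).
Variables (A : set T) (mA : measurable A) (f g : T -> R).
Hypotheses (fi : l.-integrable A (EFin \o f)) (gi : l.-integrable A (EFin \o g)).

Lemma integrable_EFinB : l.-integrable A (EFin \o (fun x => f x - g x)).
Proof. by rewrite (_ : _ \o _ = (EFin \o f) \- (EFin \o g))%E//; exact: integrableB. Qed.

Lemma integrable_maxr0 : l.-integrable A (fun x => (Num.max (f x) 0)%:E).
Proof.
rewrite (_ : (fun x => (Num.max (f x) 0)%:E) = (EFin \o f)^\+%E); first exact: integrable_funepos.
by apply/funext => x; rewrite funeposE /= EFin_max.
Qed.

Lemma integrable_EFinN : l.-integrable A (EFin \o (fun x => - f x)).
Proof. by rewrite (_ : _ \o _ = \- (EFin \o f))%E//; exact: integrableN. Qed.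

End integrable_EFin.

(** * Primitives with respect to the uniform law *)

Section cumul.
Variables (R : realType) (l : probability R R).
Hypothesis ul : uniform01 l.

(** Since [l] is carried by ]0, 1[, this is the primitive starting at 0. *)
Definition cumul (f : R -> R) (w : R) : R := \int[l]_(x in `]-oo, w]) f x.

Lemma uniform01_oc (a b : R) : 0 <= a -> a <= b -> b <= 1 ->
  l `]a, b]%classic = (b - a)%:E.
Proof.
move=> a0 ab b1; have -> : `]a, b]%classic = `]-oo, b]%classic `\` `]-oo, a]%classic.
  apply/seteqP; split => x /=; rewrite !in_itv/=.
    by move=> /andP[ax ->]; split => //; apply/negP; rewrite -ltNge.
  by move=> [-> /negP]; rewrite -ltNge => ->.
rewrite measureD//=; last by rewrite (le_lt_trans (probability_le1 _ _))// ltry.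
rewrite (_ : _ `&` _ = `]-oo, a]%classic); last first.
  by apply/setIidPr => x /=; rewrite !in_itv/= => /le_trans; apply.
by rewrite [X in (X - _)%E]ul ?[X in (_ - X)%E]ul// ?a0 ?b1 ?andbT ?(le_trans a0 ab)//
  ?(le_trans ab b1)//.
Qed.

Lemma cumulB f a b : l.-integrable setT (EFin \o f) -> a <= b ->
  cumul f b - cumul f a = \int[l]_(x in `]a, b]) f x.
Proof.
move=> fi ab; rewrite /cumul (_ : `]-oo, b]%classic = `]-oo, a]%classic `|` `]a, b]%classic).
  rewrite Rintegral_setU//; first by rewrite addrC addKr.
    by apply: integrableS fi => //; exact: measurableU.
  apply/eqP/seteqP; split => // x [] /=; rewrite !in_itv/= => xa /andP[].
  by rewrite ltNge xa.
by rewrite -itv_bndbnd_setU.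
Qed.

Lemma cumul0 f : l.-integrable setT (EFin \o f) -> cumul f 0 = 0.
Proof.
move=> fi; rewrite /cumul /Rintegral null_set_integral//.
  by case/integrableP: fi => mf _; exact: measurable_funTS.
by rewrite [LHS]ul ?lexx ?ler01.
Qed.

Lemma cumul1 f : l.-integrable setT (EFin \o f) -> cumul f 1 = \int[l]_x f x.
Proof.
move=> fi; have [mf _] := integrableP _ _ _ fi.
rewrite /cumul; congr fine; rewrite [LHS]integral_mkcond; apply: ae_eq_integral => //.
  by apply/(measurable_restrictT _ _).1 => //; exact: measurable_funTS.
apply: filterS (uniform01_01 ul) => x /andP[_ x1] _.
by rewrite patchE mem_set//= in_itv/= ltW.
Qed.

Lemma uniform01_oc_le (a b : R) : a <= b -> (l `]a, b]%classic <= (b - a)%:E)%E.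
Proof.
move=> ab; have [h|h] := leP (Num.max a 0) (Num.min b 1).
  apply: (@le_trans _ _ (Num.min b 1 - Num.max a 0)%:E); last first.
    by rewrite lee_fin lerB// ?le_max ?ge_min ?lexx.
  rewrite -uniform01_oc ?ge_min ?le_max ?lexx ?orbT//.
  apply: ae_measure_le => //; apply: filterS (uniform01_01 ul) => x /andP[x0 x1] /=.
  by rewrite !in_itv/= => /andP[ax xb]; rewrite gt_max ax x0 le_min xb ltW.
apply: (@le_trans _ _ (l set0)); last by rewrite measure0 lee_fin subr_ge0.
apply: ae_measure_le => //; apply: filterS (uniform01_01 ul) => x /andP[x0 x1] /=.
rewrite !in_itv/= => /andP[ax xb].
have : Num.max a 0 < Num.min b 1 by rewrite lt_min !gt_max (lt_le_trans ax xb) ltr01 (lt_le_trans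
  x0 xb) (lt_trans ax x1).
by rewrite ltNge (ltW h).
Qed.

(** Absolute continuity of the integral: an interval has mass at most its length. *)
Lemma cumul_uc f : l.-integrable setT (EFin \o f) -> forall e, 0 < e ->
  exists2 d : R, 0 < d & forall a b, a <= b -> b - a < d ->
    `|cumul f b - cumul f a| < e.
Proof.
move=> fi e e0; have [d [d0 h]] := integral_normr_continuous fi e0.
exists d => // a b ab bad; rewrite cumulB//.
apply: (le_lt_trans (le_normr_Rintegral _ (integrableS _ _ _ fi))) => //.
apply: h => //; apply: (@le_lt_trans _ _ (b - a)%:E); last by rewrite lte_fin.
exact: uniform01_oc_le.
Qed.

Lemma cumul_continuous f : l.-integrable setT (EFin \o f) -> continuous (cumul f).
Proof.
move=> fi x; apply/cvgrPdist_lt => e e0; have [d d0 h] := cumul_uc fi e0.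
near=> y.
have xy : `|x - y| < d by near: y; apply: cvgr_dist_lt => //; exact: cvg_id.
have [yx|/ltW yx] := leP y x; first by apply: h => //; rewrite (le_lt_trans _ xy)// ler_norm.
by rewrite distrC; apply: h => //; rewrite (le_lt_trans _ xy)// distrC ler_norm.
Unshelve. all: by end_near. Qed.

(** The bound is asked on the open interval because that is where minimality controls the integrand;
    the endpoint [b] is a null set. *)
Lemma Rintegral_oc_le f a b s : l.-integrable `]a, b] (EFin \o f) ->
  0 <= a -> a <= b -> b <= 1 -> (forall x, a < x < b -> f x <= s) ->
  \int[l]_(x in `]a, b]) f x <= s * (b - a).
Proof.
move=> fi a0 ab b1 fs.
have -> : s * (b - a) = \int[l]_(x in `]a, b]) s.
  by rewrite Rintegral_cst//= -[b - a]/(fine (b - a)%:E) -uniform01_oc.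
have sf : l.-integrable `]a, b]%classic (EFin \o (fun=> s)).
  exact: finite_measure_integrable_cst.
have sfi : l.-integrable `]a, b]%classic (EFin \o (fun x => s - f x)).
  exact: integrable_EFinB.
rewrite -subr_ge0 -RintegralB//.
rewrite /Rintegral (ae_eq_integral (fun x => (Num.max (s - f x) 0)%:E))//.
- by apply: fine_ge0; apply: integral_ge0 => x _; rewrite lee_fin le_max lexx orbT.
- by case/integrableP: sfi.
- apply/measurable_EFinP; apply: measurable_maxr => //.
  by case/integrableP: sfi => /measurable_EFinP.
- exists [set b]; split => //; first exact: uniform01_atomless.
  move=> x /= /not_implyP[/=]; rewrite in_itv/= => /andP[ax xb] /eqP ne.
  apply/eqP; rewrite eq_le xb /= leNgt; apply/negP => xb'; move/eqP: ne; apply.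
  by rewrite max_l// subr_ge0 fs// ax.
Qed.

Lemma Rintegral_oc_ge f a b s : l.-integrable `]a, b] (EFin \o f) ->
  0 <= a -> a <= b -> b <= 1 -> (forall x, a < x < b -> s <= f x) ->
  s * (b - a) <= \int[l]_(x in `]a, b]) f x.
Proof.
move=> fi a0 ab b1 fs.
have fiN : l.-integrable `]a, b]%classic (EFin \o (fun x => - f x)).
  exact: integrable_EFinN.
have := Rintegral_oc_le (s := - s) fiN a0 ab b1.
have -> : \int[l]_(x in `]a, b]) - f x = - \int[l]_(x in `]a, b]) f x.
  under eq_Rintegral do rewrite -mulN1r.
  by rewrite RintegralZl// mulN1r.
by rewrite mulNr lerN2; apply => x xab; rewrite lerN2 fs.
Qed.

Lemma argmin_ex f t : l.-integrable setT (EFin \o f) ->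
  exists2 u : R, 0 <= u <= 1 & forall w, 0 <= w <= 1 ->
    cumul f u - t * u <= cumul f w - t * w.
Proof.
move=> fi; have [||u u01 hu] := @EVT_min _ (fun w => cumul f w - t * w) 0 1.
- exact: ler01.
- apply: continuous_subspaceT => x; apply: cvgB; first exact: cumul_continuous.
  exact: mulrl_continuous.
- by exists u.
Qed.

(** A function crossing the level [t] at [a] has its hinge carried by ]a, 1]. This serves for a
    quantile function, cut at any [w], and for [isoreg], cut at [argm t]. *)
Lemma hinge_cut f a t : l.-integrable setT (EFin \o f) -> 0 <= a -> a <= 1 ->
  (forall x, 0 < x < 1 -> x <= a -> f x <= t) ->
  (forall x, 0 < x < 1 -> a < x -> t <= f x) ->
  (\int[l]_x (Num.max (f x - t) 0)%:E =
   (cumul f 1 - cumul f a - t * (1 - a))%:E)%E.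
Proof.
move=> fi a0 a1 fle fge.
have it : l.-integrable `]a, 1]%classic (EFin \o (fun=> t)).
  exact: finite_measure_integrable_cst.
have fio : l.-integrable `]a, 1]%classic (EFin \o f) by apply: integrableS fi.
have idt : l.-integrable `]a, 1]%classic (EFin \o (fun x => f x - t)).
  exact: integrable_EFinB.
have -> : cumul f 1 - cumul f a - t * (1 - a) = \int[l]_(x in `]a, 1]) (f x - t).
  rewrite RintegralB// -cumulB//; congr (_ - _).
  by rewrite Rintegral_cst//= -[1 - _]/(fine (1 - a)%:E) -uniform01_oc.
rewrite fineK; last exact: integrable_fin_num.
rewrite [RHS]integral_mkcond; apply: ae_eq_integral => //.
- have /integrableP[/measurable_EFinP mf _] := fi.
  by apply/measurable_EFinP; apply: measurable_maxr => //; exact: measurable_funB.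
- apply/(measurable_restrictT _ (measurable_itv `]a, 1])).
  by case/integrableP: idt.
- apply: filterS (uniform01_01 ul) => x /andP[x0 x1] _; rewrite patchE.
  have x01 : 0 < x < 1 by rewrite x0 x1.
  have [xt|tx] := leP x a.
    rewrite memNset/= ?in_itv/= ?ltNge ?xt// max_r// subr_le0.
    exact: fle.
  by rewrite mem_set/= ?in_itv/= ?tx ?ltW// max_l// subr_ge0 fge.
Qed.

End cumul.

(** * Slope of the greatest convex minorant *)

Section isotonic.
Variables (R : realType) (l : probability R R).
Hypothesis ul : uniform01 l.
Variable h : R -> R.
Hypothesis hi : l.-integrable setT (EFin \o h).
Let H := cumul l h.

(** A contact point of [H] with its supporting line of slope [t]. The minimiser is selected
    arbitrarily: monotonicity in [t] holds for any selection. *)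
Definition argm (t : R) : R := xget 0 [set u | 0 <= u <= 1 /\
  forall w, 0 <= w <= 1 -> cumul l h u - t * u <= cumul l h w - t * w].

Lemma argmP t : 0 <= argm t <= 1 /\
  forall w, 0 <= w <= 1 -> H (argm t) - t * argm t <= H w - t * w.
Proof.
have [u u01 hu] := argmin_ex ul t hi.
by apply: (@xgetPex _ 0 [set u | 0 <= u <= 1 /\
  forall w, 0 <= w <= 1 -> cumul l h u - t * u <= cumul l h w - t * w]); exists u.
Qed.

Lemma argm01 t : 0 <= argm t <= 1. Proof. by case: (argmP t). Qed.
Lemma argm_ge0 t : 0 <= argm t. Proof. by case/andP: (argm01 t). Qed.
Lemma argm_le1 t : argm t <= 1. Proof. by case/andP: (argm01 t). Qed.

Lemma argm_min t w : 0 <= w <= 1 -> H (argm t) - t * argm t <= H w - t * w.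
Proof. by case: (argmP t) => _; apply. Qed.

(** The two minimality inequalities add up to [0 <= (t - s) * (argm t - argm s)]. *)
Lemma argm_homo s t : s <= t -> argm s <= argm t.
Proof.
rewrite le_eqVlt => /predU1P[->//|st].
have h1 := argm_min s (argm01 t); have h2 := argm_min t (argm01 s).
by rewrite -subr_ge0 -(pmulr_rge0 _ (_ : 0 < t - s)) ?subr_gt0//; lra.
Qed.

Let C := \int[l]_x `|h x|.

Let HB a b : a <= b -> `|H b - H a| <= C.
Proof.
move=> ab; rewrite /H cumulB//.
apply: (le_trans (le_normr_Rintegral _ (integrableS _ _ _ hi))) => //.
have hn := integrable_norm hi.
apply: fine_le; rewrite ?integrable_fin_num//.
- by apply: integrableS hn.
- by apply: ge0_subset_integral => //; case/integrableP: hn.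
Qed.

Let C0 : 0 <= C.
Proof. by apply: fine_ge0; apply: integral_ge0 => x _; rewrite lee_fin. Qed.

Lemma argm_gt u : u < 1 -> exists t, u < argm t.
Proof.
(* Minimality against [w = 1] gives [t * (1 - argm t) <= C], which is less than [t * (1 - u)] for
   this [t]. *)
move=> u1; exists ((C + 1) / (1 - u)).
have p : 0 < 1 - u by rewrite subr_gt0.
set t := _ / _; have tE : t * (1 - u) = C + 1 by rewrite /t divfK// gt_eqF.
have t0 : 0 < t by rewrite divr_gt0// ltr_wpDl.
have i01 : 0 <= (1 : R) <= 1 by rewrite lexx ler01.
have h1 := argm_min t i01.
have := HB (argm_le1 t) => /(le_trans (ler_norm _)) h2.
rewrite ltNge; apply/negP => h3.
have : t * argm t <= t * u by rewrite ler_pM2l.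
lra.
Qed.

Lemma argm_lt u : 0 < u -> exists t, argm t < u.
Proof.
move=> u0; exists (- ((C + 1) / u)).
set t := _ / _; have tE : t * u = C + 1 by rewrite /t divfK// gt_eqF.
have t0 : 0 < t by rewrite divr_gt0// ltr_wpDl.
have i01 : 0 <= (0 : R) <= 1 by rewrite lexx ler01.
have h1 := argm_min (- t) i01.
have := HB (argm_ge0 (- t)); rewrite distrC => /(le_trans (ler_norm _)) h2.
rewrite ltNge; apply/negP => h3.
have : t * u <= t * argm (- t) by rewrite ler_pM2l.
lra.
Qed.

(* Slope of the greatest convex minorant of [cumul l h]; [argm] is its
   generalized inverse, and the value outside ]0, 1[ is junk. *)
Definition isoreg u : R := if 0 < u < 1 then inf [set t | u <= argm t] else 0.

(** With [isoreg_ge] this replaces a Galois connection. An arbitrary selection of minimisers need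
    not be right continuous, so [isoreg u <= t] does not give back [u <= argm t]. *)
Lemma isoreg_le u t : 0 < u < 1 -> u <= argm t -> isoreg u <= t.
Proof.
move=> u01 ut; rewrite /isoreg u01; apply: ge_inf => //.
case/andP: u01 => /argm_lt[s su] _; exists s => r /= ur.
by rewrite leNgt; apply/negP => /ltW/argm_homo; rewrite leNgt (lt_le_trans su).
Qed.

Lemma isoreg_ge u t : 0 < u < 1 -> argm t < u -> t <= isoreg u.
Proof.
move=> u01 ut; rewrite /isoreg u01; apply: lb_le_inf.
  by case/andP: u01 => _ /argm_gt[s su]; exists s => /=; exact: ltW.
move=> r /= ur; rewrite leNgt; apply/negP => /ltW/argm_homo.
by rewrite leNgt (lt_le_trans ut).
Qed.

Lemma isoreg_homo u v : 0 < u -> u <= v -> v < 1 -> isoreg u <= isoreg v.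
Proof.
move=> u0 uv v1; have v01 : 0 < v < 1 by rewrite v1 (lt_le_trans u0).
have u01 : 0 < u < 1 by rewrite u0 (le_lt_trans uv).
rewrite leNgt; apply/negP => vu; pose t := (isoreg u + isoreg v) / 2.
have h1 : isoreg v < t by rewrite /t; lra.
have h2 : t < isoreg u by rewrite /t; lra.
have [tu|ut] := ltP (argm t) u; last by have := isoreg_le u01 ut; rewrite leNgt h2.
by have := isoreg_ge v01 (lt_le_trans tu uv); rewrite leNgt h1.
Qed.

Lemma measurable_isoreg : measurable_fun setT isoreg.
Proof.
apply: (measurability _ (RGenOInfty.measurableE R)) => //.
move=> /= _ [_ [x ->]] <-; rewrite setTI.
rewrite (_ : _ @^-1` _ = (`]0, 1[%classic `&` isoreg @^-1` `]x, +oo[%classic)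
  `|` (~` `]0, 1[%classic `&` isoreg @^-1` `]x, +oo[%classic)); last first.
  by rewrite -setIUl setUv setTI.
apply: measurableU.
  apply: is_interval_measurable => u v /= [+ +] [+ +] w /andP[uw wv].
  rewrite !in_itv/= !andbT => /andP[u0 u1] xu /andP[v0 v1] _.
  have w0 := lt_le_trans u0 uw; have w1 := le_lt_trans wv v1.
  by split; rewrite ?w0// (lt_le_trans xu)// isoreg_homo.
have [x0|x0] := ltP x 0.
  rewrite (_ : _ `&` _ = ~` `]0, 1[%classic); first exact: measurableC.
  apply/setIidPl => u /= /negP; rewrite !in_itv/= /isoreg => /negbTE ->.
  by rewrite andbT.
rewrite (_ : _ `&` _ = set0)//; apply/seteqP; split => // u [] /= /negP.
by rewrite !in_itv/= /isoreg => /negbTE ->; rewrite andbT ltNge x0.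
Qed.


Lemma isoreg_bound a b u : argm a < u < argm b -> a <= isoreg u <= b.
Proof.
move=> /andP[au ub]; have u01 : 0 < u < 1.
  by rewrite (le_lt_trans (argm_ge0 a) au) (lt_le_trans ub (argm_le1 b)).
by rewrite isoreg_ge//= isoreg_le// ltW.
Qed.

Let integrable_isoreg_oc a b :
  l.-integrable `]argm a, argm b]%classic (EFin \o isoreg).
Proof.
have ci : l.-integrable `]argm a, argm b]%classic (EFin \o (fun=> `|a| + `|b|)).
  exact: finite_measure_integrable_cst.
apply: le_integrable ci => //=; first by apply/measurable_EFinP; apply: measurable_funTS;
  exact: measurable_isoreg.
move=> u; rewrite in_itv/= => /andP[au ub]; rewrite lee_fin [leRHS]ger0_norm ?addr_ge0//.
have [u01|/negbTE u01] := boolP (0 < u < 1); last by rewrite /isoreg u01 normr0 addr_ge0.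
have := isoreg_ge u01 au; have := isoreg_le u01 ub.
have := ler_norm b; have := ler_norm (- a); rewrite normrN => h1 h2 h3 h4.
have := normr_ge0 a; have := normr_ge0 b => h5 h6.
by rewrite ler_norml; apply/andP; split; lra.
Qed.

(** Defect of the identity [Rintegral_isoreg], shown to vanish by subdividing the range of
    slopes. *)
Let gap a b := \int[l]_(x in `]argm a, argm b]) isoreg x - (H (argm b) - H (argm a)).

Let gapD a b c : a <= b -> b <= c -> gap a c = gap a b + gap b c.
Proof.
move=> ab bc; have h1 := argm_homo ab; have h2 := argm_homo bc.
rewrite /gap (_ : `]argm a, argm c]%classic = `]argm a, argm b]%classic `|` `]argm b, argm
  c]%classic).
  rewrite Rintegral_setU//.
  - move: (Rintegral l `]argm a, argm b]%classic isoreg) => x.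
    move: (H (argm a)) (H (argm b)) (H (argm c)) => p q r.
    by move: (Rintegral l `]argm b, argm c]%classic isoreg) => y; ring.
  - by rewrite -itv_bndbnd_setU ?bnd_simp//; exact: integrable_isoreg_oc.
  - apply/eqP/seteqP; split => // x [] /=; rewrite !in_itv/= => /andP[_ xb] /andP[].
    by rewrite ltNge xb.
by rewrite -itv_bndbnd_setU ?bnd_simp.
Qed.

(** Both terms of the gap lie between [a] and [b] times [argm b - argm a]: the integral by
    [isoreg_bound], the increment of [H] by minimality at the two endpoints. *)
Let gap_le a b : a <= b -> `|gap a b| <= (b - a) * (argm b - argm a).
Proof.
move=> ab; have argab := argm_homo ab.
have hA : a * (argm b - argm a) <= H (argm b) - H (argm a).
  move: (argm_min a (argm01 b)).
  by move: (H (argm a)) (H (argm b)) (argm a) (argm b) {argab} => p q r s; lra.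
have hB : H (argm b) - H (argm a) <= b * (argm b - argm a).
  move: (argm_min b (argm01 a)).
  by move: (H (argm a)) (H (argm b)) (argm a) (argm b) {argab hA} => p q r s; lra.
have i1 := Rintegral_oc_le ul (integrable_isoreg_oc a b) (argm_ge0 a) argab (argm_le1 b)
  (fun x xab => proj2 (andP (isoreg_bound xab))).
have i2 := Rintegral_oc_ge ul (integrable_isoreg_oc a b) (argm_ge0 a) argab (argm_le1 b)
  (fun x xab => proj1 (andP (isoreg_bound xab))).
by rewrite ler_norml mulrBl opprB !lerB.
Qed.

(* Bisection improves the previous bound by a factor 2 each time. *)
Let gap_bisect n a b : a <= b -> `|gap a b| * 2 ^+ n <= (b - a) * (argm b - argm a).
Proof.
elim: n a b => [|n IH] a b ab; first by rewrite expr0 mulr1 gap_le.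
pose c := (a + b) / 2; have ac : a <= c by rewrite /c; lra.
have cb : c <= b by rewrite /c; lra.
have e1 : c - a = (b - a) / 2 by rewrite /c; lra.
have e2 : b - c = (b - a) / 2 by rewrite /c; lra.
rewrite (gapD ac cb) exprSr mulrA -ler_pdivlMr//.
apply: (@le_trans _ _ (`|gap a c| * 2 ^+ n + `|gap c b| * 2 ^+ n)).
  by rewrite -mulrDl ler_wpM2r ?exprn_ge0 ?ler_normD.
apply: le_trans (lerD (IH _ _ ac) (IH _ _ cb)) _.
have e : argm c - argm a + (argm b - argm c) = argm b - argm a.
  by rewrite addrC addrA subrK.
by rewrite e1 e2 -mulrDr e mulrAC.
Qed.

Lemma Rintegral_isoreg a b : a <= b ->
  \int[l]_(x in `]argm a, argm b]) isoreg x = H (argm b) - H (argm a).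
Proof.
move=> ab; apply/eqP; rewrite -subr_eq0 -normr_eq0 -/(gap a b); apply/negPn/negP => g0.
have gp : 0 < `|gap a b| by rewrite lt_neqAle eq_sym g0/=.
pose K := (b - a) * (argm b - argm a).
have K0 : 0 <= K / `|gap a b|.
  by rewrite divr_ge0// mulr_ge0// subr_ge0// argm_homo.
have := archi_boundP K0; set n := Num.bound _ => hn.
have : n%:R <= 2 ^+ n :> R by rewrite -natrX ler_nat ltnW// ltn_expl.
have := gap_bisect n ab; rewrite -/K mulrC -ler_pdivlMr// => h1 h2.
by have := lt_le_trans hn (le_trans h2 h1); rewrite ltxx.
Qed.

Lemma isoreg_ge0 u : argm 0 < u -> 0 <= isoreg u.
Proof.
move=> a0; have [u01|/negbTE u01] := boolP (0 < u < 1); first exact: isoreg_ge.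
by rewrite /isoreg u01.
Qed.

Lemma isoreg_le0 u : u <= argm 0 -> isoreg u <= 0.
Proof.
move=> a0; have [u01|/negbTE u01] := boolP (0 < u < 1); first exact: isoreg_le.
by rewrite /isoreg u01.
Qed.

(** The intervals between [argm (- n)] and [argm n] exhaust ]0, 1[. On each of them [isoreg] changes
    sign at [argm 0], and on either side the integral of its absolute value is, up to sign, an
    increment of [H], hence at most [C]. *)
Lemma integrable_isoreg : l.-integrable setT (EFin \o isoreg).
Proof.
have mf := measurable_isoreg.
apply/integrableP; split; first exact/measurable_EFinP.
pose F n := `]argm (- n%:R), argm n%:R]%classic.
have mU : measurable (\bigcup_n F n) by apply: bigcup_measurable => n _; exact: measurable_itv.
have mnF : measurable_fun (\bigcup_n F n) (fun x => `|(isoreg x)%:E|%E).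
  by apply: measurable_funTS; apply: measurableT_comp => //; exact/measurable_EFinP.
rewrite (_ : (\int[l]_x _ = \int[l]_(x in \bigcup_n F n) `|(isoreg x)%:E|)%E); last first.
  rewrite [RHS]integral_mkcond; apply: ae_eq_integral => //.
  - by apply: measurableT_comp => //; exact/measurable_EFinP.
  - exact/(measurable_restrictT _ mU).
  - apply: filterS (uniform01_01 ul) => u /andP[u0 u1] _.
    rewrite patchE mem_set//.
    have [s hs] := argm_lt u0; have [t ht] := argm_gt u1.
    exists (Num.bound `|s| + Num.bound `|t|)%N => //; rewrite /F/= in_itv/=; apply/andP; split.
    + apply: le_lt_trans hs; apply: argm_homo; rewrite lerNl natrD.
      rewrite (le_trans (ler_norm _))// normrN ler_wpDr// ltW// archi_boundP//.
    + apply: ltW; apply: lt_le_trans ht _; apply: argm_homo; rewrite natrD.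
      by rewrite (le_trans (ler_norm _))// ler_wpDl// ltW// archi_boundP.
have ndF : nondecreasing_seq F.
  move=> n m nm; apply/subsetPset/subset_itv; rewrite bnd_simp argm_homo// ?lerN2 ler_nat//.
have c : (\int[l]_(x in F i) `|(isoreg x)%:E| @[i --> \oo] --> \int[l]_(x in \bigcup_i F
  i) `|(isoreg x)%:E|)%E.
  apply: ge0_nondecreasing_set_cvg_integral => // n; first exact: measurable_itv.
  by apply: measurable_funTS; apply: measurableT_comp => //; exact/measurable_EFinP.
rewrite -(cvg_lim _ c)//; apply: (@le_lt_trans _ _ (C + C)%:E); last exact: ltry.
apply: lime_le; first by apply/cvg_ex; eexists; exact: c.
apply: nearW => n; have n0 : 0 <= n%:R :> R by [].
rewrite /F (_ : `]argm (- n%:R), argm n%:R]%classic = `]argm (- n%:R), argm 0] `|` `]argm 0, argm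
  n%:R]).
rewrite ge0_integral_setU//=; last 2 first.
  - by apply/measurable_funTS/measurable_EFinP; exact: measurableT_comp.
  - apply/eqP/seteqP; split => // x [] /=; rewrite !in_itv/= => /andP[_ xb] /andP[].
    by rewrite ltNge xb.
  have EF a b : a <= b -> (\int[l]_(x in `]argm a, argm b]) (isoreg x)%:E =
      (H (argm b) - H (argm a))%:E)%E.
    by move=> ab; rewrite -Rintegral_isoreg// fineK//; exact: integrable_fin_num.
  have HC a b : a <= b -> H (argm b) - H (argm a) <= C /\ - (H (argm b) - H (argm a)) <= C.
    move=> ab; have := HB (argm_homo ab); rewrite ler_norml => /andP[? ?].
    by split => //; rewrite lerNl.
  rewrite EFinD; apply: leeD.
    rewrite (_ : (\int[l]_(x in _) _ = \int[l]_(x in `]argm (- n%:R), argm 0]) - (isoreg x)%:E)%E).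
      rewrite integralN/=; last first.
        by apply: fin_num_adde_defr; apply: integrable_fin_num => //; exact: integrable_funepos.
      rewrite EF ?oppr_le0// -EFinN lee_fin.
      by case: (HC (- n%:R) 0); rewrite ?oppr_le0.
    apply: eq_integral => x; rewrite inE/= in_itv/= => /andP[_ x0].
    by rewrite ler0_norm// isoreg_le0.
  rewrite (_ : (\int[l]_(x in _) _ = \int[l]_(x in `]argm 0, argm n%:R]) (isoreg x)%:E)%E).
    by rewrite EF// lee_fin; case: (HC 0 n%:R).
  apply: eq_integral => x; rewrite inE/= in_itv/= => /andP[x0 _].
  by rewrite ger0_norm// isoreg_ge0.
by rewrite -itv_bndbnd_setU ?bnd_simp// argm_homo// oppr_le0.
Qed.


Let e w := cumul l (fun x => isoreg x - h x) w.

Let di : l.-integrable setT (EFin \o (fun x => isoreg x - h x)).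
Proof. by apply: integrable_EFinB => //; exact: integrable_isoreg. Qed.

Let eE w : e w = cumul l isoreg w - H w.
Proof.
rewrite /e /H /cumul RintegralB//.
- by apply: integrableS integrable_isoreg.
- by apply: integrableS hi.
Qed.

Let e_argm_eq a b : a <= b -> e (argm b) = e (argm a).
Proof.
move=> ab; have := cumulB integrable_isoreg (argm_homo ab); 
rewrite (Rintegral_isoreg ab) (eE (argm a)) (eE (argm b)).
move: (cumul l isoreg (argm a)) (cumul l isoreg (argm b)) (H (argm a)) (H (argm b)) => p q r s E.
have -> : q = p + (s - r) by rewrite -E addrC subrK.
by ring.
Qed.

(** [e] takes one value at all minimisers, these come arbitrarily close to 0, and [e] is continuous
    and vanishes at 0. *)
Let e_argm t : e (argm t) = 0.
Proof.
apply/eqP; rewrite -normr_eq0 eq_le normr_ge0 andbT; apply/ler_addgt0Pr => r r0.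
have [d d0 hd] := cumul_uc ul di r0; have [s sd] := argm_lt d0.
rewrite add0r; apply: ltW; rewrite (@e_argm_eq (Num.min s t)) ?ge_min ?lexx ?orbT//.
rewrite -[X in `|X|]subr0 -(cumul0 ul di); apply: hd; first exact: argm_ge0.
by rewrite subr0 (le_lt_trans _ sd)// argm_homo// ge_min lexx.
Qed.

Let e1 : e 1 = 0.
Proof.
apply/eqP; rewrite -normr_eq0 eq_le normr_ge0 andbT; apply/ler_addgt0Pr => r r0.
have [d d0 hd] := cumul_uc ul di r0.
have d1 : 1 - d < 1 by rewrite ltrBlDr ltrDl.
have [s sd] := argm_gt d1.
rewrite add0r; apply: ltW; rewrite -[X in `|X|]subr0 -(e_argm s).
by apply: hd; [exact: argm_le1|rewrite ltrBlDr -ltrBlDl].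
Qed.

Lemma cumul_isoreg_argm t : cumul l isoreg (argm t) = cumul l h (argm t).
Proof. by apply/eqP; rewrite -subr_eq0 -eE e_argm. Qed.

Lemma Rintegral_isoreg_setT : \int[l]_x isoreg x = \int[l]_x h x.
Proof.
have ii := integrable_isoreg.
by apply/eqP; rewrite -!(cumul1 ul)// -subr_eq0 -eE e1.
Qed.

(** For a slope [s] just below [isoreg w], the two primitives agree at the contact point
    [argm s < w]. From there to [w] the first grows with slope at most [isoreg w], and [H] by at
    least [s] times the length, by minimality. *)
Lemma cumul_isoreg_le w : 0 < w < 1 -> cumul l isoreg w <= cumul l h w.
Proof.
move=> w01; have [w0 w1] := andP w01; have ii := integrable_isoreg.
rewrite -subr_le0 -/(H w) -eE; apply/ler_addgt0Pr => r r0; rewrite add0r.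
pose s := isoreg w - r; have sw : argm s < w.
  rewrite ltNge; apply/negP => /(isoreg_le w01); apply/negP.
  by rewrite -ltNge ltrBlDr ltrDl.
have h1 : cumul l isoreg w - cumul l isoreg (argm s) <= isoreg w * (w - argm s).
  rewrite cumulB// ?(ltW sw)//; apply: (Rintegral_oc_le ul).
  - by apply: integrableS ii.
  - exact: argm_ge0.
  - exact: ltW.
  - exact: ltW.
  - by move=> x /andP[sx xw]; apply: isoreg_homo; rewrite ?(le_lt_trans (argm_ge0 _) sx)// ltW.
have h2 : s * (w - argm s) <= H w - H (argm s).
  have w01' : 0 <= w <= 1 by rewrite !ltW.
  have aux (p q x y : R) : q - y <= p - x -> x - y <= p - q by lra.
  by rewrite mulrBr; apply: aux; exact: argm_min.
rewrite eE; move: h1; rewrite (cumul_isoreg_argm s) -/(H _) => h1.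
have -> : cumul l isoreg w - H w = (cumul l isoreg w - H (argm s)) - (H w - H (argm s)) by rewrite
  opprB addrA subrK.
apply: (le_trans (lerB h1 h2)); rewrite -mulrBl /s opprB addrC subrK.
by rewrite ler_piMr ?(ltW r0)// (le_trans _ (ltW w1))// gerBl argm_ge0.
Qed.

(** The right-hand side is [H 1 - t] minus the minimum of [H w - t * w], hence the largest value
    over [w] of the lower bound for competitors. *)
Lemma hinge_isoreg t : (\int[l]_x (Num.max (isoreg x - t) 0)%:E =
  (cumul l h 1 - cumul l h (argm t) - t * (1 - argm t))%:E)%E.
Proof.
have ii := integrable_isoreg.
have e1' : cumul l isoreg 1 = cumul l h 1 by apply/eqP; rewrite -subr_eq0 -eE e1.
rewrite (hinge_cut ul ii (argm_ge0 t) (argm_le1 t)).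
- by rewrite e1' cumul_isoreg_argm.
- by move=> x x01; exact: isoreg_le.
- by move=> x x01; exact: isoreg_ge.
Qed.

(** If [h] exceeded [s + r] all the way from [x] to [argm s], then [x] would give a smaller value of
    [H w - s * w] than [argm s]. *)
Let h_left s x : 0 <= x -> x < argm s -> forall r, 0 < r ->
  exists2 y, x < y < argm s & h y <= s + r.
Proof.
move=> x0 xs r r0; apply: contrapT => N.
have hh y : x < y < argm s -> s + r <= h y.
  by move=> xys; rewrite leNgt; apply/negP => /ltW hy; apply: N; exists y.
have hio : l.-integrable `]x, argm s]%classic (EFin \o h) by apply: integrableS hi.
have := Rintegral_oc_ge ul hio x0 (ltW xs) (argm_le1 s) hh.
rewrite -cumulB ?(ltW xs)//.
have x01 : 0 <= x <= 1 by rewrite x0 (le_trans (ltW xs))// argm_le1.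
have := argm_min s x01; rewrite -/(H _) -/(H x).
have : 0 < r * (argm s - x) by rewrite mulr_gt0// subr_gt0.
have aux (p q a : R) : 0 < r * (a - x) -> p - s * a <= q - s * x ->
  (s + r) * (a - x) <= p - q -> False by move=> *; lra.
exact: aux.
Qed.

Let h_right t x : argm t < x -> x <= 1 -> forall r, 0 < r ->
  exists2 y, argm t < y < x & t - r <= h y.
Proof.
move=> tx x1 r r0; apply: contrapT => N.
have hh y : argm t < y < x -> h y <= t - r.
  by move=> xys; rewrite leNgt; apply/negP => /ltW hy; apply: N; exists y.
have hio : l.-integrable `]argm t, x]%classic (EFin \o h) by apply: integrableS hi.
have := Rintegral_oc_le ul hio (argm_ge0 t) (ltW tx) x1 hh.
rewrite -cumulB ?(ltW tx)//.
have x01 : 0 <= x <= 1 by rewrite x1 (le_trans (argm_ge0 t))// ltW.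
have := argm_min t x01; rewrite -/(H _) -/(H x).
have : 0 < r * (x - argm t) by rewrite mulr_gt0// subr_gt0.
have aux (p q a : R) : 0 < r * (x - a) -> p - t * a <= q - t * x ->
  q - p <= (t - r) * (x - a) -> False by move=> *; lra.
exact: aux.
Qed.

(** A large rise of [isoreg] between [u] and [v] must be matched by [F]. Near the contact points
    there are [y <= z] with [h y] at most about [isoreg u] and [h z] at least about [isoreg v]; as
    [G y <= G z], the whole rise is due to [F]. Left continuity of [F] brings the estimate from
    points below [u] to [u]. *)
Lemma sub_isoreg_homo (F G : R -> R) : (forall u, h u = F u - G u) ->
  (forall u v, 0 < u -> u <= v -> v < 1 -> F u <= F v) ->
  (forall u v, 0 < u -> u <= v -> v < 1 -> G u <= G v) ->
  (forall u x, 0 < u < 1 -> (forall v, 0 < v < u -> F v <= x) -> F u <= x) ->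
  forall u v, 0 < u -> u <= v -> v < 1 -> F u - isoreg u <= F v - isoreg v.
Proof.
move=> hE Fnd Gnd Flc u v u0 uv v1.
have Fuv := Fnd _ _ u0 uv v1.
have u01 : 0 < u < 1 by rewrite u0 (le_lt_trans uv).
have v01 : 0 < v < 1 by rewrite v1 (lt_le_trans u0).
rewrite leNgt; apply/negP => gap0.
(* The errors below add up to [4 * r]: one [r] for each of [s], [t], [y] and [z]. An eighth of the
   supposed drop leaves a contradiction. *)
pose r := ((F u - isoreg u) - (F v - isoreg v)) / 8.
have r0 : 0 < r by rewrite divr_gt0// subr_gt0.
pose s := isoreg u + r; pose t := isoreg v - r.
have rE : 8 * r = (F u - isoreg u) - (F v - isoreg v) by rewrite /r mulrC divfK.
have us : u <= argm s.
  by rewrite leNgt; apply/negP => /(isoreg_ge u01); rewrite /s gerDl leNgt r0.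
have tv : argm t < v.
  by rewrite ltNge; apply/negP => /(isoreg_le v01); rewrite /t lerBrDr gerDl leNgt r0.
have st : s <= t by rewrite /s /t; lra.
have [z /andP[tz zv] hz] := h_right tv (ltW v1) r0.
have z0 : 0 < z := le_lt_trans (argm_ge0 t) tz.
have h1 : F u <= F v - t + s + 2 * r.
  apply: Flc => // x /andP[x0 xu].
  have [y /andP[xy ys] hy] := h_left (ltW x0) (lt_le_trans xu us) r0.
  have yz : y <= z by rewrite ltW// (lt_trans ys)// (le_lt_trans _ tz)// argm_homo.
  have y1 : y < 1 := lt_le_trans ys (argm_le1 s).
  have h2 := Fnd _ _ x0 (ltW xy) y1.
  have h3 := Gnd _ _ (lt_trans x0 xy) yz (lt_trans zv v1).
  have h4 := Fnd _ _ z0 (ltW zv) v1.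
  move: hy hz; rewrite !hE => hy hz; lra.
move: h1; rewrite /s /t => h1; lra.
Qed.

End isotonic.

(** * Lower bound by hinge functions *)

Lemma integrable_cst1 d (T : measurableType d) (R : realType)
    (m : {measure set T -> \bar R}) (c : R) : m setT = 1%E ->
  m.-integrable setT (EFin \o (fun=> c)).
Proof.
move=> m1; apply/integrableP; split; first by apply/measurable_EFinP.
by under eq_integral do rewrite /=; rewrite integral_cst//= m1 mule1 ltry.
Qed.

Lemma ae_le_integral d (T : measurableType d) (R : realType)
    (m : {measure set T -> \bar R}) (f g : T -> \bar R) :
  m.-integrable setT f -> m.-integrable setT g ->
  {ae m, forall x, f x <= g x}%E -> (\int[m]_x f x <= \int[m]_x g x)%E.
Proof.
move=> fi gi [N [mN N0 fgN]].
rewrite (negligible_integral mN measurableT fi N0) (negligible_integral mN measurableT gi N0).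
have mD : measurable (setT `\` N) by exact: measurableD.
apply: le_integral => //; [exact: integrableS fi|exact: integrableS gi|].
by move=> x; rewrite inE => -[_ Nx]; apply: contrapT => fgx; exact/Nx/fgN.
Qed.

(** * Barycenters of a kernel with given second marginal *)

Section barycenter.
Variables (R : realType) (mu nu : probability R R) (p : R.-pker R ~> R).
Hypothesis pnu : second_marginal mu nu p.

Import HBNNSimple.

Let second_marginal_nnsfun (f : {nnsfun R >-> R}) :
  (\int[nu]_y (f y)%:E = \int[mu]_x \int[p x]_y (f y)%:E)%E.
Proof.
under [RHS]eq_integral do rewrite integralT_nnsfun sintegralE.
rewrite integralT_nnsfun sintegralE ge0_integral_fsum//.
- apply: eq_fsbigr => r /set_mem [y0 _ rE].
  rewrite ge0_integralZl//.
  + by rewrite -pnu//.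
  + exact: measurable_kernel.
  + by rewrite lee_fin -rE.
- by move=> r; apply: measurable_funeM; exact: measurable_kernel.
- move=> r x _; have [r0|r0] := leP 0 r; first by rewrite mule_ge0.
  by rewrite preimage_nnfun0// measure0 mule0.
Qed.

Lemma second_marginal_integral (k : R -> \bar R) : measurable_fun setT k ->
  (forall y, 0 <= k y)%E ->
  (\int[nu]_y k y = \int[mu]_x \int[p x]_y k y)%E.
Proof.
move=> mk k0; pose k_ := nnsfun_approx measurableT mk.
have mcv (m : {measure set R -> \bar R}) :
    (\int[m]_y k y = lim (\int[m]_y (k_ n y)%:E @[n --> \oo]))%E.
  rewrite -monotone_convergence//=.
  - apply: eq_integral => ? /[!inE] xD; apply/esym/cvg_lim => //=.
    exact: cvg_nnsfun_approx.
  - by move=> n; exact/measurable_EFinP/measurable_funTS.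
  - by move=> n ? _; rewrite lee_fin.
  - by move=> ? _ ? ? mn; rewrite lee_fin; exact/lefP/nd_nnsfun_approx.
rewrite mcv; under eq_fun do rewrite second_marginal_nnsfun.
under [RHS]eq_integral do rewrite mcv.
rewrite monotone_convergence//=.
- move=> n; apply: measurable_fun_integral_kernel.
  + by move=> U mU; exact: measurable_kernel.
  + by move=> y; rewrite lee_fin.
  + exact/measurable_EFinP.
- by move=> n x _; apply: integral_ge0 => y _; rewrite lee_fin.
- move=> x _ a b ab; apply: ge0_le_integral => //.
  + by move=> y _; rewrite lee_fin.
  + exact/measurable_EFinP.
  + exact/measurable_EFinP.
  + by move=> y _; rewrite lee_fin; exact/lefP/nd_nnsfun_approx.
Qed.

Hypothesis nu1 : finite_first_moment nu.

Let mid : measurable_fun setT (fun y : R => y%:E).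
Proof. exact/measurable_EFinP. Qed.

Let mint (k : R -> \bar R) : measurable_fun setT k -> (forall y, 0 <= k y)%E ->
  measurable_fun setT (fun x => \int[p x]_y k y)%E.
Proof.
move=> mk k0; apply: measurable_fun_integral_kernel => // U mU.
exact: measurable_kernel.
Qed.

Let pos_int : mu.-integrable setT (fun x => \int[p x]_y (EFin^\+ y))%E.
Proof.
apply/integrableP; split.
  by apply: mint => //; exact: measurable_funepos.
under eq_integral do rewrite gee0_abs ?integral_ge0//.
rewrite -second_marginal_integral//; last exact: measurable_funepos.
by apply: integrable_lty => //; exact: integrable_funepos.
Qed.

Let neg_int : mu.-integrable setT (fun x => \int[p x]_y (EFin^\- y))%E.
Proof.
apply/integrableP; split.
  by apply: mint => //; exact: measurable_funeneg.
under eq_integral do rewrite gee0_abs ?integral_ge0//.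
rewrite -second_marginal_integral//; last exact: measurable_funeneg.
by apply: integrable_lty => //; exact: integrable_funeneg.
Qed.

(** [barycenter] may be a default value where [p x] has no first moment; the first moment of [nu]
    confines such points to a null set. *)
Lemma ae_integrable_kernel : {ae mu, forall x, (p x).-integrable setT (fun y : R => y%:E)}.
Proof.
have h1 := integrable_ae measurableT pos_int.
have h2 := integrable_ae measurableT neg_int.
apply: filterS2 h1 h2 => x /(_ I) f1 /(_ I) f2.
apply/integrableP; split => //.
have -> : (\int[p x]_y `|y%:E| = \int[p x]_y (EFin^\+ y + EFin^\- y))%E.
  by apply: eq_integral => y _; rewrite -[RHS]/((EFin^\+ \+ EFin^\-)%E y) -fune_abse.
rewrite ge0_integralD//.
- by rewrite lte_add_pinfty// ltey_eq ?f1 ?f2.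
- exact: measurable_funepos.
- exact: measurable_funeneg.
Qed.

Lemma measurable_barycenter : measurable_fun setT (barycenter p).
Proof.
rewrite [barycenter p](_ : _ =
  fine \o (fun x => (\int[p x]_y (EFin^\+ y) - \int[p x]_y (EFin^\- y))%E)).
  apply: measurableT_comp => //.
  by apply: emeasurable_funB; [case/integrableP: pos_int|case/integrableP: neg_int].
by apply/funext => x; rewrite /barycenter/= integralE.
Qed.

Let B x : \bar R := (\int[p x]_y (EFin^\+ y) - \int[p x]_y (EFin^\- y))%E.

Let iB : mu.-integrable setT B.
Proof. exact: integrableB. Qed.

Let bB : {ae mu, forall x, (barycenter p x)%:E = B x}.
Proof.
apply: filterS ae_integrable_kernel => x xi.
by rewrite /B -integralE /barycenter fineK//; exact: integrable_fin_num.
Qed.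

Lemma integrable_barycenter : mu.-integrable setT (EFin \o barycenter p).
Proof.
have mb := measurable_barycenter.
apply/integrableP; split; first exact/measurable_EFinP.
have /integrableP[mB] := iB; apply: le_lt_trans.
rewrite le_eqVlt; apply/orP; left; apply/eqP; apply: ae_eq_integral => //.
- by apply: measurableT_comp => //; exact/measurable_EFinP.
- exact: measurableT_comp.
- by apply: filterS bB => x e _; rewrite -e.
Qed.

Lemma integral_barycenter : (\int[mu]_x (barycenter p x)%:E = \int[nu]_y y%:E)%E.
Proof.
have mb := measurable_barycenter; have /integrableP[mB _] := iB.
rewrite (ae_eq_integral B)//.
- rewrite integralB// -second_marginal_integral//; last exact: measurable_funepos.
  by rewrite -second_marginal_integral//; [rewrite [RHS]integralE|exact: measurable_funeneg].
- exact/measurable_EFinP.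
- by apply: filterS bB => x e _; rewrite -e.
Qed.

(* For [0 <= w <= 1] and any level [c], [w y <= w c + (y - c)^+]. *)
Lemma integral_weighted_barycenter_le (w : R -> R) (c : R) :
  measurable_fun setT w -> (forall x, 0 <= w x <= 1) ->
  (\int[mu]_x (w x * barycenter p x)%:E <=
   c%:E * \int[mu]_x (w x)%:E + \int[nu]_y (Num.max (y - c) 0)%:E)%E.
Proof.
move=> mw w01.
have mmax : measurable_fun setT (fun y : R => (Num.max (y - c) 0)%:E).
  by apply/measurable_EFinP; apply: measurable_maxr => //; exact: measurable_funB.
have max0 (y : R) : (0 <= (Num.max (y - c) 0)%:E)%E by rewrite lee_fin le_max lexx orbT.
have wi : mu.-integrable setT (EFin \o w).
  have ci : mu.-integrable setT (EFin \o (fun=> 1)) by exact: finite_measure_integrable_cst.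
  apply: le_integrable ci => //; first exact/measurable_EFinP.
  by move=> x _ /=; rewrite lee_fin normr1 ger0_norm; case/andP: (w01 x).
have maxi (m : {measure set R -> \bar R}) : m setT = 1%E ->
    m.-integrable setT (fun y : R => y%:E) ->
    m.-integrable setT (fun y : R => (Num.max (y - c) 0)%:E).
  move=> m1 mi; suff yci : m.-integrable setT (EFin \o (fun y => y - c)).
    by have h := integrable_maxr0 measurableT yci; exact: h.
  by apply: integrable_EFinB => //; exact: integrable_cst1.
have Mi : mu.-integrable setT (fun x => \int[p x]_y (Num.max (y - c) 0)%:E)%E.
  apply/integrableP; split; first exact: mint.
  under eq_integral do rewrite gee0_abs ?integral_ge0//.
  rewrite -second_marginal_integral//; apply: integrable_lty => //; apply: maxi => //;
    exact: probability_setT.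
rewrite -integralZl// second_marginal_integral// -integralD//; last exact: integrableZl.
have mb := measurable_barycenter.
apply: ae_le_integral.
- apply: le_integrable integrable_barycenter => //.
    by apply/measurable_EFinP; exact: measurable_funM.
  move=> x _ /=; rewrite lee_fin normrM ler_piMl//.
  by have /andP[w0 w1] := w01 x; rewrite ger0_norm.
- by apply: integrableD => //; exact: integrableZl.
apply: filterS ae_integrable_kernel => x xi.
have yi : (p x).-integrable setT (fun y : R => (w x * y)%:E).
  by under eq_fun do rewrite EFinM; exact: integrableZl.
have -> : (w x * barycenter p x)%:E = (\int[p x]_y (w x * y)%:E)%E.
  under eq_integral do rewrite EFinM.
  by rewrite integralZl// EFinM /barycenter fineK//; exact: integrable_fin_num.
have p1 : p x setT = 1%E by exact: prob_kernel.
have ci : (p x).-integrable setT (EFin \o (fun=> c * w x)) by exact: integrable_cst1.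
have mi := maxi _ p1 xi.
have -> : (c%:E * (EFin \o w) x = \int[p x]_y (c * w x)%:E)%E.
  by rewrite integral_cst//= p1 mule1 EFinM.
rewrite -integralD//; apply: le_integral => //; first exact: integrableD.
move=> y _ /=; rewrite -EFinD lee_fin.
have /andP[w0 w1] := w01 x.
rewrite -lerBlDl [c * _]mulrC -mulrBr.
have [yc|yc] := leP (y - c) 0; last by rewrite ler_piMl// ltW.
by rewrite mulr_ge0_le0.
Qed.

End barycenter.

(** * Hinge bounds for an arbitrary coupling *)

Section competitor.
Variables (R : realType) (l : probability R R).
Hypothesis ul : uniform01 l.

Lemma integrable_qf m : finite_first_moment m -> l.-integrable setT (EFin \o qf m).
Proof.
move=> m1; apply: (iffLR (has_law_integrable (uniform01_qf ul m) (@measurable_id _ _ setT))).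
exact: m1.
Qed.

Lemma integral_qf m : finite_first_moment m ->
  (\int[m]_x x%:E = (cumul l (qf m) 1)%:E)%E.
Proof.
move=> m1; have qi := integrable_qf m1.
rewrite (cumul1 ul)// fineK; last exact: integrable_fin_num.
exact: (has_law_integral (uniform01_qf ul m) (@measurable_id _ _ setT)).
Qed.

Lemma hinge_qf m w : finite_first_moment m -> 0 < w < 1 ->
  (\int[m]_y (Num.max (y - qf m w) 0)%:E =
   (cumul l (qf m) 1 - cumul l (qf m) w - qf m w * (1 - w))%:E)%E.
Proof.
move=> m1 /andP[w0 w1].
have mmax : measurable_fun setT (fun y : R => (Num.max (y - qf m w) 0)%:E).
  by apply/measurable_EFinP; apply: measurable_maxr => //; exact: measurable_funB.
rewrite (has_law_ge0_integral (uniform01_qf ul m))//; last first.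
  by move=> y; rewrite lee_fin le_max lexx orbT.
apply: hinge_cut => //; [exact: integrable_qf|exact: ltW|exact: ltW|..].
- by move=> x /andP[x0 x1] xw; exact: qf_homo.
- by move=> x /andP[x0 x1] /ltW xw; exact: qf_homo.
Qed.

Variables (mu nu : probability R R) (p : R.-pker R ~> R).
Hypothesis mu1 : finite_first_moment mu.
Hypothesis nu1 : finite_first_moment nu.
Hypothesis pnu : second_marginal mu nu p.
Let F := qf mu.
Let G := qf nu.
Let b := barycenter p.

Let ib : mu.-integrable setT (EFin \o b).
Proof. exact: integrable_barycenter pnu nu1. Qed.

(** For [0 <= om <= 1] the product [om * (z - t)] is at most [(z - t)^+]: the weight relaxes the
    indicator of [z > t], so that an atom can be split. *)
Let competitor_weight (om : R -> R) (A B W t : R) :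
  measurable_fun setT om -> (forall x, 0 <= om x <= 1) ->
  (\int[mu]_x (om x * x)%:E = A%:E)%E ->
  (\int[mu]_x (om x * b x)%:E <= B%:E)%E ->
  (\int[mu]_x (om x)%:E = W%:E)%E ->
  ((A - B - t * W)%:E <= \int[mu]_x (Num.max (x - b x - t) 0)%:E)%E.
Proof.
move=> mom om01 hA hB hW.
have omi (k : R -> R) : mu.-integrable setT (EFin \o k) -> mu.-integrable setT (EFin \o (fun x =>
  om x * k x)).
  move=> ki; have /integrableP[/measurable_EFinP mk _] := ki.
  apply: le_integrable ki => //; first by apply/measurable_EFinP; exact: measurable_funM.
  move=> x _ /=; rewrite lee_fin normrM ler_piMl//.
  by have /andP[? ?] := om01 x; rewrite ger0_norm.
have ti : mu.-integrable setT (EFin \o (fun=> t)) by exact: finite_measure_integrable_cst.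
have i1 := omi id mu1; have i2 := omi b ib; have i3 := omi _ ti.
have i4 : mu.-integrable setT (EFin \o (fun x => om x * x - om x * b x)) by exact: integrable_EFinB.
have i5 : mu.-integrable setT (EFin \o (fun x => om x * x - om x * b x - om x * t)).
  exact: integrable_EFinB.
apply: (@le_trans _ _ (\int[mu]_x (om x * x - om x * b x - om x * t)%:E)%E).
  under eq_integral do rewrite EFinB.
  rewrite integralB//; under eq_integral do rewrite EFinB.
  rewrite integralB// hA; under [X in (_ <= _ - X)%E]eq_integral do rewrite EFinM muleC.
  rewrite integralZl//; last first.
    have := omi (fun=> 1) (integrable_cst1 1 (@probability_setT _ _ _ mu)).
    by under eq_fun do rewrite mulr1.
  rewrite hW -EFinM !EFinB; apply: leeB => //; exact: leeB.
have ei : mu.-integrable setT (EFin \o (fun x => x - b x - t)).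
  by apply: integrable_EFinB => //; exact: integrable_EFinB.
have mi := integrable_maxr0 measurableT ei.
apply: le_integral => // x _; rewrite lee_fin -mulrBr -mulrBr.
have /andP[om_ge0 om_le1] := om01 x.
have [h|h] := leP (x - b x - t) 0; first by rewrite mulr_ge0_le0.
by rewrite ler_piMl// ltW.
Qed.

(** The cut [w] and the level [t] are independent here; they are matched only when compared with the
    optimal kernel. The cuts 0 and 1 are treated apart since [qf] is a default value there. *)
Lemma competitor_hinge w t : 0 <= w <= 1 ->
  ((cumul l F 1 - cumul l G 1 - (cumul l F w - cumul l G w) - t * (1 - w))%:E <=
   \int[mu]_x (Num.max (x - b x - t) 0)%:E)%E.
Proof.
move=> /andP[]; rewrite le_eqVlt => /predU1P[<- _|w0].
  rewrite !(cumul0 ul); [|exact: integrable_qf|exact: integrable_qf].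
  rewrite subrr !subr0; apply: (@competitor_weight (fun=> 1)) => //.
  - by move=> x; rewrite ler01 lexx.
  - by under eq_integral do rewrite mul1r; exact: integral_qf.
  - under eq_integral do rewrite mul1r.
    by rewrite (integral_barycenter pnu nu1) integral_qf.
  - by rewrite integral_cst//= probability_setT mule1.
rewrite le_eqVlt => /predU1P[->|w1].
  rewrite !subrr mulr0 subrr; apply: integral_ge0 => x _.
  by rewrite lee_fin le_max lexx orbT.
have w01 : 0 < w < 1 by rewrite w0 w1.
pose om x := 1 - qweight mu w x.
have mom : measurable_fun setT om by apply: measurable_funB => //; exact: measurable_qweight.
have om01 x : 0 <= om x <= 1.
  by have /andP[h1 h2] := qweight01 mu w01 x; rewrite /om subr_ge0 h2 gerBl.
have iom : (\int[mu]_x (om x)%:E = (1 - w)%:E)%E.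
  rewrite /om; under eq_integral do rewrite EFinB.
  rewrite integralB//; [|exact: integrable_cst1 (probability_setT _)|].
    by rewrite integral_cst//= probability_setT mule1 integral_qweight.
  apply: (le_integrable measurableT _ _ (integrable_cst1 1 (@probability_setT _ _ _ mu))) => //.
    by apply/measurable_EFinP; exact: measurable_qweight.
  move=> x _ /=; rewrite lee_fin normr1 ger0_norm; by case/andP: (qweight01 mu w01 x).
have mmax (c : R) : measurable_fun setT (fun y : R => (Num.max (y - c) 0)%:E).
  by apply/measurable_EFinP; apply: measurable_maxr => //; exact: measurable_funB.
have -> : cumul l F 1 - cumul l G 1 - (cumul l F w - cumul l G w) =
    (cumul l F 1 - cumul l F w) - (cumul l G 1 - cumul l G w).
  by move: (cumul l F 1) (cumul l F w) (cumul l G 1) (cumul l G w) => a1 a2 a3 a4; ring.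
apply: (@competitor_weight om) => //.
(* [om] is 1 above the quantile and 0 below it, so [om x * (x - F w)] is exactly the hinge at [F w],
   whatever the share kept of the atom. *)
- have omx x : om x * x = F w * om x + Num.max (x - F w) 0.
    rewrite /om qweightE -/F; case: ltgtP => h.
    + by rewrite subrr mul0r mulr0 add0r max_r// subr_le0 ltW.
    + by rewrite subr0 mul1r mulr1 max_l ?subr_ge0 ?ltW// addrC subrK.
    + by rewrite h subrr maxxx addr0 mulrC.
  under eq_integral do rewrite omx EFinD EFinM.
  have omI : mu.-integrable setT (fun x => (om x)%:E).
    apply: (le_integrable measurableT _ _ (integrable_cst1 1 (@probability_setT _ _ _ mu))) => //.
      exact/measurable_EFinP.
    move=> x _ /=; rewrite lee_fin normr1 ger0_norm; by case/andP: (om01 x).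
  have maxI : mu.-integrable setT (fun x : R => (Num.max (x - F w) 0)%:E).
    apply/integrableP; split => //.
    under eq_integral do rewrite gee0_abs ?lee_fin ?le_max ?lexx ?orbT//.
    by rewrite (hinge_qf mu1 w01) ltry.
  rewrite integralD//; last exact: integrableZl.
  rewrite integralZl// iom (hinge_qf mu1 w01) -EFinM -EFinD.
  by rewrite addrC subrK.
(* The threshold [G w] makes the bound equal to the top part [cumul l G 1 - cumul l G w]. *)
- apply: le_trans (integral_weighted_barycenter_le pnu nu1 (G w) mom om01) _.
  rewrite iom (hinge_qf nu1 w01) -EFinM -EFinD lee_fin.
  by rewrite addrC subrK.
Qed.

End competitor.

(** * Approximation of a cost by hinges *)

Section cost_function.
Variables (R : realType) (th : R -> R).
Hypothesis cth : cost_function th.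

Let th_ge0 x : 0 <= th x. Proof. by case: cth. Qed.
Let th0 : th 0 = 0. Proof. by case: cth. Qed.

Lemma cost_conv x y t : 0 <= t <= 1 ->
  th (t * x + (1 - t) * y) <= t * th x + (1 - t) * th y.
Proof. by case: cth => _ + _ _; apply. Qed.

Lemma cost_homo x y : 0 <= x -> x <= y -> th x <= th y.
Proof.
move=> x0 xy; have [y0|y0] := eqVneq y 0.
  by have -> : x = y by apply/eqP; rewrite eq_le xy y0.
have yp : 0 < y by rewrite lt_neqAle eq_sym y0 (le_trans x0).
have t01 : 0 <= x / y <= 1 by rewrite divr_ge0 ?(ltW yp)//= ler_pdivrMr// mul1r.
have := cost_conv y 0 t01; rewrite mulr0 addr0 th0 mulr0 addr0 divfK// => /le_trans; apply.
by case/andP: t01 => ? ?; rewrite ler_piMl.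
Qed.

Lemma measurable_cost_norm d (T : measurableType d) (f : T -> R) : measurable_fun setT f ->
  measurable_fun setT (fun t => th `|f t|).
Proof.
move=> mf; have -> : (fun t => th `|f t|) = (fun y => th (Num.max y 0)) \o (fun t => `|f t|).
  by apply/funext => t /=; rewrite max_l.
apply: measurableT_comp; last exact: measurableT_comp.
apply: nondecreasing_measurable => // x y xy; apply: cost_homo.
  by rewrite le_max lexx orbT.
by rewrite ge_max !le_max xy lexx orbT.
Qed.

(** Convexity at [x], seen as the mean of [x - d] and [x + 1] with weights [1 / (1 + d)] and
    [d / (1 + d)]; the term [d * th x] is dropped. *)
Lemma cost_modulus x d : 0 <= d -> th x - th (x - d) <= d * th (x + 1).
Proof.
move=> d0; have d1 : 0 < 1 + d by rewrite ltr_wpDr.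
have t01 : 0 <= 1 / (1 + d) <= 1.
  by rewrite divr_ge0 ?(ltW d1)//= ler_pdivrMr// mul1r lerDl.
have := cost_conv (x - d) (x + 1) t01.
have eD : 1 - 1 / (1 + d) = d / (1 + d) by rewrite -{1}(divff (lt0r_neq0 d1)) -mulrBl addrC addKr.
rewrite eD; have -> : 1 / (1 + d) * (x - d) + d / (1 + d) * (x + 1) = x.
  by field; rewrite lt0r_neq0.
rewrite mulrAC mul1r mulrAC -mulrDl ler_pdivlMr// mulrDr mulr1 => h.
have : 0 <= th x * d by rewrite mulr_ge0.
lra.
Qed.

Variable dl : R.
Hypothesis dl0 : 0 < dl.

Let s k : R := th (k.+1%:R * dl) - th (k%:R * dl).

Let s_homo k : s k <= s k.+1.
Proof.
have half : 0 <= (1 / 2 : R) <= 1 by lra.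
have := cost_conv (k.+2%:R * dl) (k%:R * dl) half.
have -> : 1 / 2 * (k.+2%:R * dl) + (1 - 1 / 2) * (k%:R * dl) = k.+1%:R * dl.
  by rewrite -!natr1; field.
rewrite /s; lra.
Qed.

(* Slope increments of the piecewise linear interpolation of [th] on the grid [dl * N]. *)
Definition kink k : R := (if k is k'.+1 then s k - s k' else s 0) / dl.

Lemma kink_ge0 k : 0 <= kink k.
Proof.
rewrite /kink divr_ge0 ?(ltW dl0)//; case: k => [|k]; last by rewrite subr_ge0.
by rewrite /s mul0r th0 subr0.
Qed.

(** The thresholds start at [dl]: within the reach of the grid this is the interpolation of [th]
    evaluated one cell to the left. Chords of a convex function lie above it, but the shift puts the
    sum below [th] on the half-line, and all thresholds are positive, as [abs_hinge_le] requires. *)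
Definition hinge_sum n (x : R) : R :=
  \sum_(k < n) kink k * Num.max (x - k.+1%:R * dl) 0.

Lemma hinge_sumE j y : j.+1%:R * dl <= y ->
  hinge_sum j.+1 y = th (j%:R * dl) + (y - j.+1%:R * dl) * (s j / dl).
Proof.
elim: j => [|j IH] jy; rewrite /hinge_sum big_ord_recr/=.
  by rewrite big_ord0 add0r mul0r th0 add0r max_l ?subr_ge0// /kink mulrC.
have jy' : j.+1%:R * dl <= y by rewrite (le_trans _ jy)// ler_pM2r// ler_nat.
rewrite -/(hinge_sum j.+1 y) IH// max_l ?subr_ge0// /kink.
rewrite /s -!natr1; field; exact: lt0r_neq0.
Qed.

Lemma hinge_sum_homo n m y : (n <= m)%N -> hinge_sum n y <= hinge_sum m y.
Proof.
move=> nm; rewrite /hinge_sum -(subnKC nm) big_split_ord/= lerDl.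
by apply: sumr_ge0 => i _; rewrite mulr_ge0 ?kink_ge0// le_max lexx orbT.
Qed.

Lemma hinge_sum_eq j n y : (j <= n)%N -> y <= j.+1%:R * dl -> hinge_sum n y = hinge_sum j y.
Proof.
move=> jn yj; rewrite /hinge_sum -(subnKC jn) big_split_ord/=.
rewrite [X in _ + X]big1 ?addr0// => i _; rewrite max_r ?mulr0// subr_le0.
by rewrite (le_trans yj)// ler_pM2r// ler_nat ltnS leq_addr.
Qed.

Let cell y : dl <= y -> exists j, j.+1%:R * dl <= y < j.+2%:R * dl.
Proof.
move=> y1; have y0 : 0 <= y / dl by rewrite divr_ge0 ?(ltW dl0)// (le_trans _ y1)// ltW.
have /andP[h1 h2] := truncn_itv y0.
have t1 : 1 <= y / dl by rewrite ler_pdivlMr// mul1r.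
move: h1 h2; case: (Num.truncn _) => [|j] h1 h2; first by rewrite ltNge t1 in h2.
by exists j; rewrite -ler_pdivlMr// h1/= -ltr_pdivrMr.
Qed.

Let hinge_sum_small n y : y <= dl -> hinge_sum n y = 0.
Proof. by move=> ydl; rewrite (@hinge_sum_eq 0%N)// ?mul1r// /hinge_sum big_ord0. Qed.

Let cell_bounds n y j : (j < n)%N -> j.+1%:R * dl <= y < j.+2%:R * dl ->
  th (j%:R * dl) <= hinge_sum n y <= th (j.+1%:R * dl).
Proof.
move=> jn /andP[jy yj].
rewrite (hinge_sum_eq jn (ltW yj)) hinge_sumE//.
have sj0 : 0 <= s j.
  rewrite /s subr_ge0; apply: cost_homo; first by rewrite mulr_ge0// ltW.
  by rewrite ler_pM2r// ler_nat.
have q0 : 0 <= (y - j.+1%:R * dl) / dl by rewrite divr_ge0 ?subr_ge0 ?(ltW dl0).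
have q1 : (y - j.+1%:R * dl) / dl <= 1.
  by rewrite ler_pdivrMr// mul1r lerBlDl (le_trans (ltW yj))// -(natr1 j.+1) mulrDl mul1r.
have eS : th (j.+1%:R * dl) = th (j%:R * dl) + s j by rewrite /s addrC subrK.
by rewrite mulrCA lerDl mulr_ge0//= eS lerD2l ler_piMr.
Qed.

Lemma hinge_sum_le n y : 0 <= y -> hinge_sum n y <= th y.
Proof.
move=> y0; have [ydl|/cell[j jy]] := ltP y dl.
  by rewrite hinge_sum_small ?th_ge0// ltW.
apply: (le_trans (hinge_sum_homo y (leq_maxl n j.+1))).
have /andP[_ h] := cell_bounds (leq_maxr n j.+1) jy.
apply: (le_trans h); apply: cost_homo; first by rewrite mulr_ge0// ltW.
by case/andP: jy.
Qed.

(** The shift and the width of a cell cost at most [2 * dl] in the argument, which [cost_modulus]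
    converts into an error in value. *)
Lemma hinge_sum_ge n y : 0 <= y -> y <= n%:R * dl ->
  th y <= hinge_sum n y + 2 * dl * th (y + 1).
Proof.
move=> y0 yn; have [ydl|/cell[j jy]] := ltP y dl.
  rewrite hinge_sum_small ?(ltW ydl)// add0r.
  have := cost_modulus y y0; rewrite subrr th0 subr0 => /le_trans; apply.
  by rewrite ler_wpM2r// (le_trans (ltW ydl))// ler_pMl// ler1n.
have /andP[jy1 jy2] := jy.
have jn : (j < n)%N by rewrite -(ler_nat R) -(ler_pM2r dl0) (le_trans jy1).
have /andP[h _] := cell_bounds jn jy.
have d0 : 0 <= y - j%:R * dl by rewrite subr_ge0 (le_trans _ jy1)// ler_pM2r// ler_nat.
have := cost_modulus y d0; rewrite subKr lerBlDl => /le_trans; apply.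
apply: lerD => //; rewrite ler_wpM2r// lerBlDl -mulrDl ltW//.
by move: jy2; rewrite -[j.+2]addn2 natrD.
Qed.

End cost_function.

(** * From hinges to all cost functions *)

Section hinge_domination.
Context d (T : measurableType d) (R : realType) (m : probability T R).
Variables e e' : T -> R.
Hypotheses (ei : m.-integrable setT (EFin \o e)) (ei' : m.-integrable setT (EFin \o e')).
Hypothesis mean : (\int[m]_x (e x)%:E = \int[m]_x (e' x)%:E)%E.
Hypothesis hinge : forall t : R, (\int[m]_x (Num.max (e x - t) 0)%:E <=
  \int[m]_x (Num.max (e' x - t) 0)%:E)%E.

Let measurable_of (f : T -> R) : m.-integrable setT (EFin \o f) -> measurable_fun setT f.
Proof. by case/integrableP => /measurable_EFinP. Qed.

(** [(|f| - a)^+ = (f - a)^+ + (- f - a)^+], and the last term is [(f + a)^+ - f - a]. This is how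
    the equality of the means enters. *)
Let abs_hinge_split (f : T -> R) (a : R) : 0 < a -> m.-integrable setT (EFin \o f) ->
  (\int[m]_x (Num.max (`|f x| - a) 0)%:E = \int[m]_x (Num.max (f x - a) 0)%:E +
    (\int[m]_x (Num.max (f x - - a) 0)%:E - \int[m]_x (f x)%:E - a%:E))%E.
Proof.
move=> a0 fi; have mf := measurable_of fi.
have ci (c : R) : m.-integrable setT (EFin \o (fun=> c)) by exact: finite_measure_integrable_cst.
have fci c : m.-integrable setT (EFin \o (fun x => f x - c)) by exact: integrable_EFinB.
have hi c : m.-integrable setT (EFin \o (fun x => Num.max (f x - c) 0)).
  by have h := integrable_maxr0 measurableT (fci c); exact: h.
have -> : (a%:E = \int[m]_x a%:E)%E by rewrite integral_cst//= probability_setT mule1.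
rewrite -integralB//; last exact: hi.
rewrite -integralB//; last 2 first.
- by have := integrable_EFinB measurableT (hi (- a)) fi.
- exact: ci.
rewrite -integralD//; last 2 first.
- exact: hi.
- by have := integrable_EFinB measurableT (integrable_EFinB measurableT (hi (- a)) fi) (ci a).
apply: eq_integral => x _; rewrite -!EFinB -EFinD; congr EFin.
rewrite opprK; have [f0|f0] := leP 0 (f x).
  rewrite ger0_norm// [X in _ + (X - _ - _)]max_l ?addr_ge0// ?(ltW a0)//.
  by rewrite [f x + a]addrC addrK subrr addr0.
rewrite ltr0_norm// [X in _ = X + _]max_r; last by rewrite subr_le0 (le_trans (ltW f0))// ltW.
rewrite add0r; have [h|h] := leP (f x + a) 0.
  by rewrite max_l; lra.
by rewrite max_r; lra.
Qed.

Lemma abs_hinge_le (a : R) : 0 < a -> (\int[m]_x (Num.max (`|e x| - a) 0)%:E <=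
  \int[m]_x (Num.max (`|e' x| - a) 0)%:E)%E.
Proof.
move=> a0; rewrite !abs_hinge_split// -mean; apply: leeD => //.
by apply: leeB => //; apply: leeB.
Qed.

Variable th : R -> R.
Hypothesis cth : cost_function th.

(** With mesh [1 / (n + 1)] and [(n + 1)^2] hinges, the mesh shrinks while the grid reaches up to
    [n + 1]. *)
Let app n (x : R) := hinge_sum th n.+1%:R^-1 (n.+1 * n.+1) x.

Let dl0 n : 0 < n.+1%:R^-1 :> R. Proof. by rewrite invr_gt0. Qed.

Let app_ge0 n x : 0 <= app n x.
Proof.
apply: sumr_ge0 => i _; rewrite mulr_ge0 ?le_max ?lexx ?orbT//.
exact: kink_ge0.
Qed.

Let mapp n : measurable_fun setT (app n).
Proof.
apply: measurable_sum => i; apply: measurable_funM => //.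
by apply: measurable_maxr => //; exact: measurable_funB.
Qed.

Let integral_app_le n : (\int[m]_x (app n `|e x|)%:E <= \int[m]_x (app n `|e' x|)%:E)%E.
Proof.
have E (f : T -> R) : measurable_fun setT f -> (\int[m]_x (app n `|f x|)%:E =
  \sum_(k < n.+1 * n.+1) (kink th n.+1%:R^-1 k)%:E * \int[m]_x (Num.max (`|f x| - k.+1%:R /
    n.+1%:R) 0)%:E)%E.
  move=> mf; under eq_integral do rewrite /app/hinge_sum -sumEFin.
  have mmax k : measurable_fun setT (fun x => (Num.max (`|f x| - k.+1%:R / n.+1%:R) 0)%:E).
    apply/measurable_EFinP; apply: measurable_maxr => //; apply: measurable_funB => //.
    exact: measurableT_comp.
  rewrite ge0_integral_sum//.
  - apply: eq_bigr => k _; under eq_integral do rewrite EFinM.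
    rewrite ge0_integralZl//.
    by rewrite lee_fin kink_ge0.
  - move=> k; under eq_fun do rewrite EFinM.
    exact: measurable_funeM.
  - by move=> k x _; rewrite lee_fin mulr_ge0 ?kink_ge0// le_max lexx orbT.
rewrite !E; [|exact: measurable_of|exact: measurable_of].
apply: lee_sum => k _; apply: lee_wpmul2l; first by rewrite lee_fin kink_ge0.
by apply: abs_hinge_le; rewrite divr_gt0.
Qed.

Let app_cvg (x : R) : (app n `|x|)%:E @[n --> \oo] --> (th `|x|)%:E.
Proof.
apply: cvg_EFin; first exact: nearW.
apply/cvgrPdist_le => r r0; near=> n.
have nx : `|x| <= n%:R by near: n; exact: nbhs_infty_ger.
have nr : 2 * th (`|x| + 1) / r <= n%:R by near: n; exact: nbhs_infty_ger.
have nn : n%:R <= n.+1%:R :> R by rewrite ler_nat.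
have h1 : app n `|x| <= th `|x| by apply: hinge_sum_le.
have h2 : th `|x| <= app n `|x| + 2 * n.+1%:R^-1 * th (`|x| + 1).
  by apply: hinge_sum_ge => //; rewrite natrM mulfK// (le_trans nx).
rewrite ger0_norm ?subr_ge0// lerBlDl; apply: (le_trans h2); rewrite lerD2l.
rewrite mulrAC ler_pdivrMr//.
by have := le_trans nr nn; rewrite ler_pdivrMr// [_ * r]mulrC.
Unshelve. all: by end_near. Qed.

(** Approximation from below: Fatou on the side of [e], the bound of [app n] by [th] on the side of
    [e']. Infinite costs are covered. *)
Lemma hinge_domination : (\int[m]_x (th `|e x|)%:E <= \int[m]_x (th `|e' x|)%:E)%E.
Proof.
have me := measurable_of ei; have me' := measurable_of ei'.
have mne : measurable_fun setT (fun x => `|e x|) by exact: measurableT_comp.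
have mne' : measurable_fun setT (fun x => `|e' x|) by exact: measurableT_comp.
have th_ge0 x : 0 <= th x by case: cth.
rewrite (eq_integral (fun x => limn_einf (fun n => (app n `|e x|)%:E))); last first.
  move=> x _; rewrite is_cvg_limn_einfE; last by apply/cvg_ex; eexists; exact: app_cvg.
  by apply/esym/cvg_lim => //; exact: app_cvg.
apply: (@le_trans _ _ (limn_einf (fun n => \int[m]_x (app n `|e x|)%:E)%E)).
  apply: fatou => //; last by move=> n x _; rewrite lee_fin.
  by move=> n; apply/measurable_EFinP; exact: measurableT_comp.
rewrite limn_einf_lim; apply: lime_le; first exact: is_cvg_einfs.
apply: nearW => n; apply: (@le_trans _ _ (\int[m]_x (app n `|e x|)%:E)%E).
  by apply: ereal_inf_lbound; exists n => /=.
apply: (le_trans (integral_app_le n)).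
apply: ge0_le_integral => //.
- by move=> x _; rewrite lee_fin.
- by apply/measurable_EFinP; exact: measurableT_comp.
- by apply/measurable_EFinP; exact: measurable_cost_norm.
- by move=> x _; rewrite lee_fin; exact: hinge_sum_le.
Qed.

End hinge_domination.

(** * The optimal kernel *)

Section random_kernel.
Context d (T : measurableType d) (R : realType) (P : probability T R).
Variable Phi : R * T -> R.
Hypothesis mPhi : measurable_fun setT Phi.

Let mPhi1 x : measurable_fun setT (fun z => Phi (x, z)).
Proof. by apply: measurableT_comp => //; exact: measurable_fun_pair. Qed.

Let X x : {mfun T >-> R} := HB.pack (fun z => Phi (x, z))
  (isMeasurableFun.Build _ _ _ _ _ (mPhi1 x)).

Let rk (x : R) : {measure set R -> \bar R} := distribution P (X x).

Let rkE x B : rk x B = P (xsection (Phi @^-1` B) x).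
Proof.
rewrite /rk /distribution /pushforward/=; congr (P _).
by apply/seteqP; split => z /=; rewrite /xsection/= inE.
Qed.

Let measurable_rk B : measurable B -> measurable_fun [set: R] (rk ^~ B).
Proof.
move=> mB; rewrite (_ : rk ^~ B = P \o xsection (Phi @^-1` B)); last by apply/funext => x;
  exact: rkE.
by apply: measurable_fun_xsection; rewrite -[X in measurable X]setTI; exact: mPhi.
Qed.

#[local] HB.instance Definition _ := isKernel.Build _ _ _ _ R rk measurable_rk.

Let rk_prob x : rk x [set: R] = 1%E.
Proof. exact: (probability_setT (distribution P (X x))). Qed.

#[local] HB.instance Definition _ := Kernel_isProbability.Build _ _ _ _ R rk rk_prob.

Lemma random_kernel : exists r : R.-pker R ~> R, forall x,
  (forall B, r x B = P ((fun z => Phi (x, z)) @^-1` B)) /\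
  (forall k : R -> R, measurable_fun setT k -> (r x).-integrable setT (EFin \o k) ->
    P.-integrable setT (fun z => (k (Phi (x, z)))%:E) /\
    \int[r x]_y (k y)%:E = \int[P]_z (k (Phi (x, z)))%:E)%E.
Proof.
exists rk => x; split => // k mk ki.
have L : has_law P (fun z => Phi (x, z)) (distribution P (X x)) by split.
have ki' := iffLR (has_law_integrable L mk) ki.
by split => //; rewrite -(has_law_integral L mk).
Qed.

End random_kernel.

Lemma ae_product d1 d2 (T1 : measurableType d1) (T2 : measurableType d2) (R : realType)
    (m1 : probability T1 R) (m2 : probability T2 R) (Q : T1 * T2 -> Prop) :
  {ae (m1 \x m2)%E, forall z, Q z} -> {ae m1, forall x, {ae m2, forall y, Q (x, y)}}.
Proof.
move=> [N [mN N0 QN]].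
have mx : measurable_fun setT (m2 \o xsection N) by exact: measurable_fun_xsection.
have /ae_eq_integral_abs : (\int[m1]_(x in setT) `|(m2 \o xsection N) x| = 0)%E.
  by rewrite -[RHS]N0; apply: eq_integral => x _; rewrite gee0_abs.
move=> /(_ measurableT mx); apply: filterS => x /(_ I) /= h.
exists (xsection N x); split => //; first exact: measurable_xsection.
by move=> y /= nQ; rewrite /xsection/= inE; exact: QN.
Qed.

(** * Construction and optimality of the common kernel *)

Section optimal_kernel.
Variables (R : realType) (l : probability R R).
Hypothesis ul : uniform01 l.

Lemma uniform01_if (q a b : R) : 0 <= q <= 1 ->
  (\int[l]_w (if w <= q then a else b)%:E = ((1 - q) * b + q * a)%:E)%E.
Proof.
move=> q01; rewrite (eq_integral (fun w => (cst b w + (a - b) * \1_(`]-oo, q]%classic) w)%:E));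
  last first.
  move=> w _; rewrite indicE /cst; case: ifPn => wq.
    by rewrite mem_set/= ?in_itv//= mulr1 addrC subrK.
  by rewrite memNset/= ?in_itv/= ?mulr0 ?addr0//; exact/negP.
have ii : l.-integrable setT (EFin \o (\1_(`]-oo, q]%classic) : R -> R)).
  exact: integrable_indic.
under eq_integral do rewrite EFinD EFinM.
rewrite integralD//=.
- rewrite integral_cst//= probability_setT mule1 integralZl// integral_indic// setIT.
  by rewrite [X in (_ * X)%E](ul q01) -EFinM -EFinD; congr EFin; ring.
- exact: integrable_cst1 (probability_setT _).
- exact: integrableZl.
Qed.

Variables mu nu : probability R R.
Hypothesis mu1 : finite_first_moment mu.
Hypothesis nu1 : finite_first_moment nu.
Let F := qf mu.
Let G := qf nu.
Let h u := F u - G u.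
Let f := isoreg l h.

Let iF : l.-integrable setT (EFin \o F). Proof. exact: integrable_qf. Qed.
Let iG : l.-integrable setT (EFin \o G). Proof. exact: integrable_qf. Qed.
Let ih : l.-integrable setT (EFin \o h). Proof. exact: integrable_EFinB. Qed.
Let jf : l.-integrable setT (EFin \o f). Proof. exact: integrable_isoreg. Qed.
Let mF : measurable_fun setT F. Proof. exact: measurable_qf. Qed.
Let mG : measurable_fun setT G. Proof. exact: measurable_qf. Qed.
Let mf : measurable_fun setT f. Proof. exact: measurable_isoreg. Qed.

Let cumulh w : cumul l h w = cumul l F w - cumul l G w.
Proof.
rewrite /cumul /h RintegralB//.
- by apply: integrableS iF.
- by apply: integrableS iG.
Qed.

Let swap : exists chi pi : R -> R, [/\
  measurable_fun setT chi, measurable_fun setT pi, forall u, 0 <= pi u <= 1,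
  {ae l, forall u, (1 - pi u) * G u + pi u * G (chi u) = F u - f u} &
  forall k : R -> \bar R, measurable_fun setT k -> (forall x, 0 <= k x)%E ->
    (\int[l]_u ((1 - pi u)%:E * k (G u) + (pi u)%:E * k (G (chi u))) =
     \int[l]_u k (G u))%E].
Proof.
have E u : F u - f u - G u = h u - f u by rewrite /h addrAC.
have hfi : l.-integrable setT (EFin \o (fun u => h u - f u)) by exact: integrable_EFinB.
apply: (martingale_swap ul (g := fun u => F u - f u)) => //.
- exact: measurable_funB.
- by rewrite (_ : _ \o _ = EFin \o (fun u => h u - f u))//; apply/funext => u /=; rewrite E.
- apply: (sub_isoreg_homo ul ih) => //.
  + by move=> u v; exact: qf_homo.
  + by move=> u v; exact: qf_homo.
  (* Left continuity of the quantile function, read through Galois: [u - r <= cdfR mu x] for all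
     small [r] gives [u <= cdfR mu x]. *)
  + move=> u x u01 H; rewrite qf_le//; apply/ler_addgt0Pr => r r0.
    rewrite -lerBlDr; have [ur|ur] := leP (u - r) 0; first exact: le_trans ur (cdfR_ge0 _ _).
    have ru : u - r < u by rewrite ltrBlDr ltrDl.
    have [_ u1] := andP u01.
    by rewrite -qf_le ?ur ?(lt_trans ru)//; apply: H; rewrite ur.
- move=> w w01; under eq_integral do rewrite E.
  have hfw : l.-integrable `]-oo, w]%classic (EFin \o (fun u => h u - f u)) by apply: integrableS
    hfi.
  rewrite -[leRHS]fineK; last exact: integrable_fin_num hfw.
  rewrite lee_fin -/(Rintegral _ _ _) RintegralB//.
  + by rewrite subr_ge0; exact: cumul_isoreg_le.
  + by apply: integrableS ih.
  + by apply: integrableS jf.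
- under eq_integral do rewrite E.
  rewrite -[LHS]fineK; last exact: integrable_fin_num hfi.
  rewrite -/(Rintegral _ _ _) RintegralB//.
  by rewrite (Rintegral_isoreg_setT ul ih) subrr.
Qed.

(** Two independent uniform variables randomize the kernel: the first selects a level [u] above [x],
    the second decides with probability [pi u] whether to move to [G (chi u)] or to [G u]. *)
Lemma optimal_kernel : exists r : R.-pker R ~> R, second_marginal mu nu r /\
  forall t : R, (\int[mu]_x (Num.max (x - barycenter r x - t) 0)%:E <=
    (cumul l h 1 - cumul l h (argm l h t) - t * (1 - argm l h t))%:E)%E.
Proof.
have [chi [pi [mchi mpi pi01 mart law]]] := swap.
pose Y (z : R * R) := if z.2 <= pi z.1 then G (chi z.1) else G z.1.
have mY : measurable_fun setT Y.
  apply: measurable_fun_ifT; last exact: measurableT_comp.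
    by apply: measurable_fun_ler => //; exact: measurableT_comp.
  by apply: measurableT_comp => //; exact: measurableT_comp.
have mU := measurable_rdt mu.
pose Phi (z : R * (R * R)) := Y (rdt mu (z.1, z.2.1), z.2.2).
have mU3 : measurable_fun setT (fun z : R * (R * R) => rdt mu (z.1, z.2.1)).
  apply: measurableT_comp => //; apply: measurable_fun_pair => //.
  by apply: measurableT_comp => //; exact: measurable_snd.
have mPhi : measurable_fun setT Phi.
  apply: measurableT_comp => //; apply: measurable_fun_pair => //.
  by apply: measurableT_comp => //; exact: measurable_snd.
have [r rE] := random_kernel (l \x l)%E mPhi.
have rnu : second_marginal mu nu r.
  move=> B mB.
  pose k := (\1_B : R -> R); have mk : measurable_fun setT k by exact: measurable_indic.
  have k0 u : 0 <= k u by rewrite /k indicE.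
  pose kap u := (1 - pi u) * k (G u) + pi u * k (G (chi u)).
  have kap0 u : 0 <= kap u.
    by have /andP[p0 p1] := pi01 u; rewrite addr_ge0 ?mulr_ge0 ?subr_ge0.
  have mkap : measurable_fun setT kap.
    apply: measurable_funD; apply: measurable_funM => //.
    - exact: measurable_funB.
    - exact: measurableT_comp.
    - by apply: measurableT_comp => //; exact: measurableT_comp.
  have sec u : l [set w | B (Y (u, w))] = (kap u)%:E.
    have mS : measurable [set w | B (Y (u, w))].
      rewrite -[X in measurable X]setTI.
      have : measurable_fun setT (fun w => Y (u, w)).
        by apply: measurableT_comp => //; exact: measurable_fun_pair.
      by move=> /(_ measurableT B mB).
    rewrite -[X in l X]setIT -integral_indic// -(uniform01_if _ _ (pi01 u)).
    apply: eq_integral => w _; rewrite /k !indicE /Y/=.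
    by case: ifPn => wpi; congr ((_ : bool)%:R)%:E; apply/idP/idP;
      rewrite !inE/= ?wpi ?(negbTE wpi).
  have rB x : r x B = (\int[l]_v (kap (rdt mu (x, v)))%:E)%E.
    rewrite (rE x).1; apply: eq_integral => v _ /=; rewrite -sec; congr (l _).
    by apply/seteqP; split => w; rewrite /xsection/= inE.
  have mK : measurable_fun setT (fun z => (kap (rdt mu z))%:E).
    by apply/measurable_EFinP; exact: measurableT_comp.
  under eq_integral do rewrite rB.
  have -> : (\int[mu]_x \int[l]_v (kap (rdt mu (x, v)))%:E =
      \int[(mu \x l)%E]_z (kap (rdt mu z))%:E)%E.
    by rewrite fubini_tonelli1// => z; rewrite lee_fin.
  have mkapE : measurable_fun setT (fun u => (kap u)%:E) by exact/measurable_EFinP.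
  have mkE : measurable_fun setT (fun u => (k u)%:E) by exact/measurable_EFinP.
  rewrite -(has_law_ge0_integral (rdt_law ul mu) mkapE); last by move=> u; rewrite lee_fin.
  under eq_integral do rewrite /kap EFinD !EFinM.
  rewrite (law _ mkE); last by move=> u; rewrite lee_fin.
  rewrite -(has_law_ge0_integral (uniform01_qf ul nu) mkE); last by move=> u; rewrite lee_fin.
  by rewrite integral_indic// setIT.
exists r; split => // t.
(* Since [qf mu (rdt mu (x, v)) = x] almost surely, the displacement at [x] is the average of [f]
   over the levels attached to [x]. *)
pose a x := \int[l]_v f (rdt mu (x, v)).
have fUi : (mu \x l)%E.-integrable setT (EFin \o (f \o rdt mu)).
  exact: (iffLR (has_law_integrable (rdt_law ul mu) mf) jf).
have fsec := ae_integrable1 fUi.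
have bary : {ae mu, forall x, x - barycenter r x = a x /\
    l.-integrable setT (EFin \o (fun v => f (rdt mu (x, v))))}.
  have ae1 : {ae (mu \x l)%E, forall z, (1 - pi (rdt mu z)) * G (rdt mu z)
      + pi (rdt mu z) * G (chi (rdt mu z)) = z.1 - f (rdt mu z)}.
    by apply: filterS2 (qf_rdt ul mu) (has_law_ae (rdt_law ul mu) mart) => z <- ->.
  apply: filterS3 (ae_product ae1) fsec (ae_integrable_kernel rnu nu1) => x h1 h2 h3.
  split=> //.
  have [Pi rI] := (rE x).2 id (@measurable_id _ _ setT) h3.
  have mUx : measurable_fun setT (fun v => rdt mu (x, v)).
    by apply: measurableT_comp => //; exact: measurable_fun_pair.
  have ci : l.-integrable setT (EFin \o (fun=> x)) by exact: finite_measure_integrable_cst.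
  have rI' : (\int[r x]_y y%:E = \int[l]_v (x - f (rdt mu (x, v)))%:E)%E.
    rewrite [LHS]rI -(integral12_prod_meas1 Pi)/=.
    under eq_integral do rewrite /fubini_F/= /Phi/Y/= uniform01_if//.
    apply: ae_eq_integral => //.
    - apply/measurable_EFinP; apply: measurable_funD; apply: measurable_funM.
      + by apply: measurable_funB => //; exact: measurableT_comp.
      + exact: measurableT_comp.
      + exact: measurableT_comp.
      + by apply: measurableT_comp => //; exact: measurableT_comp.
    - by apply/measurable_EFinP; apply: measurable_funB => //; exact: measurableT_comp.
    - by apply: filterS h1 => v e _; rewrite e.
  rewrite /barycenter rI' -/(Rintegral _ _ _) RintegralB//.
  by rewrite Rintegral_cst//= probability_setT mulr1 opprB addrC subrK.
rewrite -(hinge_isoreg ul ih) -/f.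
have mmax : measurable_fun setT (fun u => (Num.max (f u - t) 0)%:E).
  by apply/measurable_EFinP; apply: measurable_maxr => //; exact: measurable_funB.
have max0 u : (0 <= (Num.max u 0)%:E :> \bar R)%E by rewrite lee_fin le_max lexx orbT.
have mmaxU : measurable_fun setT (fun z => (Num.max (f (rdt mu z) - t) 0)%:E).
  exact: measurableT_comp mmax mU.
rewrite (has_law_ge0_integral (rdt_law ul mu) mmax)// fubini_tonelli1//.
have mb := measurable_barycenter rnu nu1.
apply: ae_ge0_le_integral => //.
- apply/measurable_EFinP; apply: measurable_maxr => //.
  by apply: measurable_funB => //; exact: measurable_funB.
- by move=> x _; apply: integral_ge0.
- exact: measurable_fun_fubini_tonelli_F.
apply: filterS bary => x [-> fxi] _.
have ci : l.-integrable setT (EFin \o (fun=> t)) by exact: finite_measure_integrable_cst.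
have fti := integrable_EFinB measurableT fxi ci.
have aE : (a x - t)%:E = (\int[l]_v (f (rdt mu (x, v)) - t)%:E)%E.
  rewrite -[RHS]fineK; last exact: integrable_fin_num fti.
  congr EFin; rewrite -/(Rintegral _ _ _) RintegralB//.
  by rewrite Rintegral_cst//= probability_setT mulr1.
have mxi := integrable_maxr0 measurableT fti.
(* Jensen for the hinge: the positive part of an average is at most the average of the positive
   parts. *)
have [ale|ale] := leP (a x - t) 0; first exact: integral_ge0.
by rewrite aE; apply: le_integral => // v _; rewrite lee_fin le_max lexx.
Qed.

Lemma optimal_kernel_le (r p : R.-pker R ~> R) (th : R -> R) :
  second_marginal mu nu r -> second_marginal mu nu p -> cost_function th ->
  (forall t : R, (\int[mu]_x (Num.max (x - barycenter r x - t) 0)%:E <=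
    (cumul l h 1 - cumul l h (argm l h t) - t * (1 - argm l h t))%:E)%E) ->
  (\int[mu]_x (th `|x - barycenter r x|)%:E <=
   \int[mu]_x (th `|x - barycenter p x|)%:E)%E.
Proof.
move=> rnu pnu cth rh.
have ib q : second_marginal mu nu q ->
    mu.-integrable setT (EFin \o barycenter q) by move=> qnu; exact: integrable_barycenter qnu nu1.
have di q : second_marginal mu nu q -> mu.-integrable setT (EFin \o (fun x => x - barycenter q x)).
  by move=> qnu; apply: integrable_EFinB => //; exact: ib.
have mean q : second_marginal mu nu q -> (\int[mu]_x (x - barycenter q x)%:E =
    \int[mu]_x x%:E - \int[nu]_y y%:E)%E.
  move=> qnu; under eq_integral do rewrite EFinB.
  by rewrite integralB//; [rewrite (integral_barycenter qnu nu1)|exact: ib].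
apply: hinge_domination => //; [exact: di|exact: di|by rewrite !mean|].
move=> t; apply: (le_trans (rh t)); rewrite 2!cumulh.
(* The cut [w = argm t] makes the lower bound for [p] coincide with the upper bound for [r]. *)
have := competitor_hinge ul mu1 nu1 pnu t (argm01 ul ih t).
by congr (_ <= _)%E.
Qed.

(** The order of quantifiers matters: [r] is chosen before [th], so additivity reduces to linearity
    of one integral. *)
Lemma optimal_coupling : exists2 r : R.-pker R ~> R, second_marginal mu nu r &
  forall th, cost_function th ->
    weak_cost th mu nu = (\int[mu]_x (th `|x - barycenter r x|)%:E)%E.
Proof.
have [r [rnu rh]] := optimal_kernel; exists r => // th cth.
apply/eqP; rewrite eq_le; apply/andP; split.
  by apply: ereal_inf_lbound; exists r.
by apply: le_ereal_inf_tmp => _ [p /= pnu <-]; exact: optimal_kernel_le.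
Qed.

End optimal_kernel.

Theorem theorem2p3 (R : realType) (al be th : R -> R) :
  cost_function al -> cost_function be -> cost_function th ->
  (forall x, al x + be x = th x) ->
  forall mu nu : probability R R,
    finite_first_moment mu -> finite_first_moment nu ->
    weak_cost th mu nu = (weak_cost al mu nu + weak_cost be mu nu)%E.
Proof.
move=> cal cbe cth hth mu nu mu1 nu1.
have [l ul] := uniform01_ex R.
have [r rnu E] := optimal_coupling ul mu1 nu1.
have mb : measurable_fun setT (fun x : R => x - barycenter r x).
  by apply: measurable_funB => //; exact: measurable_barycenter rnu nu1.
have ge0 (t : R -> R) : cost_function t -> forall x, (0 <= (t x)%:E)%E.
  by case=> _ _ t0 _ x; rewrite lee_fin.
rewrite (E _ cth) (E _ cal) (E _ cbe) -ge0_integralD//=.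
- by apply: eq_integral => x _; rewrite -EFinD hth.
- by move=> x _; exact: ge0.
- by apply/measurable_EFinP; exact: measurable_cost_norm.
- by move=> x _; exact: ge0.
- by apply/measurable_EFinP; exact: measurable_cost_norm.
Qed.
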